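(* There exists an absolute constant $C>0$ such that the following holds. Let $p$ be a prime, let $H,K>0$ be real numbers, let $J\ge 1$ be an integer, and let $I_1^{(j)}, I_2^{(j)}\subseteq (0,p)$, for $1\le j\le J$, be subintervals such that $$|I_1^{(j)}|=H\quad\text{and}\quad |I_2^{(j)}|=K\quad\text{for all } 1\le j\le J,$$ and $$I_1^{(j)}\cap I_1^{(k)}=\emptyset\quad\text{for all}\quad j\neq k.$$ If $$J\ge C\,\frac{p^{3}(\log p)^4}{H^2K^2},$$ then there exist $j\in\{1,\ldots,J\}$ and integers $x\in I_1^{(j)}$, $y\in I_2^{(j)}$ such that $xy\equiv 1 \pmod p$.
   Context: For an interval $I\subseteq\mathbb{R}$, $|I|$ denotes its length, and $\log$ is the natural logarithm. A hypothesis of the form $A\gg B$ means that $A\ge C B$ for a suitable (sufficiently large) absolute constant $C>0$; it is written out explicitly in the claim. *)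

(* Defs.v *)
From mathcomp Require Import all_boot all_order all_algebra.
From mathcomp Require Import all_classical all_reals all_analysis.

(* Main.v *)
Require Import Defs.
From HB Require Import structures.
From mathcomp Require Import all_boot all_order all_algebra all_field.
From mathcomp Require Import all_classical all_reals all_analysis.
From mathcomp Require Import zify ring lra.
Set Implicit Arguments.
Unset Strict Implicit.
Unset Printing Implicit Defensive.
Import Order.TTheory GRing.Theory Num.Theory.
Local Open Scope ring_scope.

(** If no solution exists, detect the congruence [xy = 1] by additive characters
on smoothed (convolution) counts inside the boxes.  Weil's bound
[|K(a, b)| <= 2 sqrt p] says that [x -> e(b / x)] has a flat Fourier transform;
by Parseval its sums over windows of length [m] have square mean [O(m)], and
since the windows are disjoint, Cauchy-Schwarz over all of them gives
[J m^2 n^2 <= 4 p^3] for windows of lengths [2 m] and [2 n]: no logarithm is lost.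

Weil's bound is proved by Stepanov's method.  The characters
[Lam(X^d + c_(d-1) X^(d-1) + ... + c_0) = psi(- c_(d-1) - b c_1 / c_0)] of monic
polynomials over [F_p] are multiplicative, and their L-function is
[1 + K T + p T^2].  Factoring every polynomial of degree [d <= n] in a common
finite extension turns its logarithmic derivative into
[S_d = - (al^d + be^d)], where [S_d] is the Kloosterman sum over the field with
[p^d] elements and [al], [be] are the reciprocal roots.  Stepanov's auxiliary
polynomial bounds [S_(2s)] by [O(p^(s+1))], which excludes [K^2 > 4p] by letting
[s] grow. *)

(** * Stepanov's method *)

(** Fewer conditions than unknowns: the rank is at most [k * l], below [m * n], so the kernel is
    nonzero. This produces the auxiliary polynomial of Stepanov's method. *)
Lemma linear_ker_neq0 (F : fieldType) (m n k l : nat)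
    (f : 'M[F]_(m, n) -> 'M[F]_(k, l)) :
  linear f -> (k * l < m * n)%N -> exists2 A, A != 0 & f A = 0.
Proof.
move=> lf lt_kl; pose fL := GRing.isLinear.Build _ _ _ _ f lf.
pose g : {linear _ -> _} := HB.pack f fL; rewrite -[f]/(g : _ -> _).
have : kermx (lin_mx g) != 0.
  rewrite -mxrank_eq0 mxrank_ker -lt0n subn_gt0.
  exact: leq_ltn_trans (rank_leq_col _) lt_kl.
case/rowV0Pn=> v /sub_kermxP kv v0; exists (vec_mx v).
  by rewrite -(inj_eq (can_inj mxvecK)) vec_mxK linear0.
by apply: (can_inj mxvecK); rewrite -mul_vec_lin vec_mxK kv linear0.
Qed.

Lemma size_sum_staggered (F : fieldType) (a G : nat -> {poly F}) (D c n : nat) :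
  (forall r, size (G r) = (D * r + c).+1) -> (forall r, (size (a r) <= D)%N) ->
  (size (\sum_(r < n) a r * G r)%R <= D * n + c)%N.
Proof.
move=> sG sa; apply: (leq_trans (size_sum _ _ _)); apply/bigmax_leqP => r _.
apply: (leq_trans (size_polyMleq _ _)); rewrite sG.
have := sa r; have := ltn_ord r; nia.
Qed.

(** A nonzero [a r * G r] has degree at least [D * r + c] and below [D * r.+1 + c]. These ranges are
    disjoint, so the last nonzero term cannot be cancelled. *)
Lemma sum_staggered_neq0 (F : fieldType) (a G : nat -> {poly F}) (D c n : nat) :
  (forall r, size (G r) = (D * r + c).+1) -> (forall r, (size (a r) <= D)%N) ->
  (exists2 r, (r < n)%N & a r != 0) -> \sum_(r < n) a r * G r != 0.
Proof.
move=> sG sa; elim: n => [|n IHn] [r] // rn ar.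
rewrite big_ord_recr /=; have [an|an] := eqVneq (a n) 0.
  rewrite an mul0r addr0; apply: IHn; exists r => //.
  by move: rn; rewrite ltnS leq_eqVlt => /predU1P[rn|//]; rewrite rn an eqxx in ar.
have Gn : G n != 0 by rewrite -size_poly_gt0 sG.
rewrite addrC -size_poly_gt0 size_polyDl size_mul // sG.
  by rewrite addnS /= addn_gt0 size_poly_gt0 an.
apply: leq_ltn_trans (size_sum_staggered n sG sa) _.
by rewrite addnS /= -[X in (X < _)%N]add0n ltn_add2r size_poly_gt0.
Qed.

Lemma prod_XsubC_exp_dvdp (F : fieldType) (f : {poly F}) (m : nat) (X : seq F) :
  uniq X -> (forall x, x \in X -> ('X - x%:P) ^+ m %| f) ->
  (\prod_(x <- X) ('X - x%:P)) ^+ m %| f.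
Proof.
elim: X => [|x X IHX] /=; first by rewrite big_nil expr1n dvd1p.
case/andP=> xX uX dvdX; rewrite big_cons exprMn Gauss_dvdp.
  by rewrite dvdX ?mem_head // IHX // => y yX; apply: dvdX; rewrite inE yX orbT.
apply: coprimep_expl; apply: coprimep_expr.
by rewrite coprimep_sym coprimep_XsubC root_prod_XsubC.
Qed.

Lemma size_multiple_roots (F : fieldType) (f : {poly F}) (m : nat) (X : seq F) :
  f != 0 -> uniq X -> (forall x, x \in X -> ('X - x%:P) ^+ m %| f) ->
  (m * size X < size f)%N.
Proof.
move=> f0 uX /(prod_XsubC_exp_dvdp uX) dvdf.
apply: leq_trans (dvdp_leq f0 dvdf).
have P0 : (\prod_(x <- X) ('X - x%:P)) ^+ m != 0.
  by rewrite expf_neq0 // monic_neq0 // monic_prod_XsubC.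
by rewrite -size_poly_gt0 in P0; rewrite -(prednK P0) size_exp size_prod_XsubC mulnC.
Qed.

(** Taylor's formula at [x]. Divided (Hasse) derivatives are used because, unlike iterated ones,
    they still detect multiplicities beyond the characteristic. *)
Lemma dvdp_XsubC_exp_nderivn (F : fieldType) (f : {poly F}) (x : F) (m : nat) :
  (forall k, (k < m)%N -> f^`N(k).[x] = 0) -> ('X - x%:P) ^+ m %| f.
Proof.
move=> fx.
have -> : f = \sum_(i < size f) (f^`N(i).[x])%:P * ('X - x%:P) ^+ i.
  have := @nderiv_taylor {poly F} (map_poly polyC f) x%:P ('X - x%:P) (mulrC _ _).
  rewrite addrC subrK -/(comp_poly _ _) comp_polyXr size_map_polyC => {1}->.
  by apply: eq_bigr => i _; rewrite nderivn_map horner_map.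
apply: (big_ind (fun u => _ %| u)) => [|u v|i _]; [exact: dvdp0|exact: dvdp_add|].
have [lt_im|le_mi] := ltnP i m; first by rewrite fx // polyC0 mul0r dvdp0.
by rewrite dvdp_mull // dvdp_exp2l.
Qed.

Lemma size_poly_mul_leq (R : nzRingType) (f g : {poly R}) (a b : nat) :
  (size f <= a.+1)%N -> (size g <= b.+1)%N -> (size (f * g)%R <= (a + b).+1)%N.
Proof. by move=> sf sg; apply: (leq_trans (size_polyMleq _ _)); lia. Qed.

Lemma size_poly_expn_leq (R : nzRingType) (f : {poly R}) (a n : nat) :
  (size f <= a.+1)%N -> (size (f ^+ n)%R <= (a * n).+1)%N.
Proof.
move=> sf; apply: (leq_trans (size_poly_exp_leq _ _)).
by rewrite ltnS leq_mul2r -subn1 leq_subLR add1n sf orbT.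
Qed.

Lemma size_poly_mul_eq (R : idomainType) (f g : {poly R}) (a b : nat) :
  size f = a.+1 -> size g = b.+1 -> size (f * g) = (a + b).+1.
Proof.
by move=> sf sg; rewrite size_mul -1?size_poly_gt0 ?sf ?sg ?addnS //;
  rewrite -size_poly_gt0 ?sf ?sg.
Qed.

Lemma size_poly_expn_eq (R : idomainType) (f : {poly R}) (a n : nat) :
  size f = a.+1 -> size (f ^+ n) = (a * n).+1.
Proof.
move=> sf; have f0 : f != 0 by rewrite -size_poly_gt0 sf.
by rewrite -[LHS]prednK ?size_poly_gt0 ?expf_neq0 // size_exp sf.
Qed.

Lemma exprD_pchar (R : comNzRingType) (p s : nat) (u v : R) : p \in [pchar R] ->
  (u + v) ^+ (p ^ s) = u ^+ (p ^ s) + v ^+ (p ^ s).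
Proof.
move=> pR; apply: exprDn_pchar; rewrite pnatX pnatE ?(pcharf_prime pR) //.
by rewrite pR.
Qed.

Lemma exprB_pchar (R : comNzRingType) (p s : nat) (u v : R) : p \in [pchar R] ->
  (u - v) ^+ (p ^ s) = u ^+ (p ^ s) - v ^+ (p ^ s).
Proof.
by move=> pR; apply/eqP; rewrite eq_sym subr_eq -exprD_pchar // subrK.
Qed.

Lemma expr_sum_pchar (R : comNzRingType) (p s : nat) (I : Type) (r : seq I)
    (f : I -> R) : p \in [pchar R] ->
  (\sum_(i <- r) f i) ^+ (p ^ s) = \sum_(i <- r) f i ^+ (p ^ s).
Proof.
move=> pR; elim: r => [|i r IHr]; last by rewrite !big_cons exprD_pchar // IHr.
by rewrite !big_nil expr0n expn_eq0 eqn0Ngt prime_gt0 // (pcharf_prime pR).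
Qed.

(* [X^w (\sum_(i < s) X^(p^i) + B X^-(p^i))] with [w = p^(s-1)] clearing the pole at 0. *)
Definition trace_poly (F : fieldType) (p s : nat) (B : F) : {poly F} :=
  \sum_(i < s) ('X^(p ^ s.-1 + p ^ i) + B *: 'X^(p ^ s.-1 - p ^ i)).

Lemma size_trace_poly (F : fieldType) (p s : nat) (B : F) : (1 < p)%N -> (0 < s)%N ->
  size (trace_poly p s B) = (2 * p ^ s.-1).+1 /\ trace_poly p s B \is monic.
Proof.
move=> p1; case: s => // s _; rewrite /trace_poly /= big_ord_recr /= subnn expr0.
set w := (p ^ s)%N; set g : {poly F} := \sum_(i < s) _.
have w0 : (0 < w)%N by rewrite expn_gt0 ltnW.
have szg : (size (g + B *: 1)%R <= 2 * w)%N.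
  apply: (leq_trans (size_polyD _ _)); rewrite geq_max; apply/andP; split.
    apply: (leq_trans (size_sum _ _ _)); apply/bigmax_leqP => i _.
    have lt_pi : (p ^ i < w)%N by rewrite ltn_exp2l.
    apply: (leq_trans (size_polyD _ _)); rewrite geq_max size_polyXn.
    rewrite (leq_trans (size_scale_leq _ _)) ?size_polyXn; lia.
  by rewrite (leq_trans (size_scale_leq _ _)) ?size_poly1; lia.
rewrite addrCA addnn -mul2n; split; last rewrite monicE.
  by rewrite size_polyDl size_polyXn.
by rewrite lead_coefDl ?lead_coefXn ?size_polyXn.
Qed.

Lemma horner_trace_poly (F : fieldType) (p s : nat) (B x : F) : (1 < p)%N -> x != 0 ->
  (trace_poly p s B).[x] =
    x ^+ (p ^ s.-1) * \sum_(i < s) (x ^+ (p ^ i) + B * x ^- (p ^ i)).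
Proof.
move=> p1 x0; rewrite /trace_poly horner_sum mulr_sumr; apply: eq_bigr => i _.
have le_i : (p ^ i <= p ^ s.-1)%N by rewrite leq_exp2l //; have := ltn_ord i; lia.
by rewrite hornerD hornerZ !hornerXn mulrDr exprD expfB_cond ?(negPf x0) //= mulrCA.
Qed.

(** With Q = p^s and [B] in the prime field, the sum is the trace of x + B / x from the field with
    Q^2 elements. Each of its p values should occur about Q^2 / p times; the excess is at most 6
    Q. *)
Lemma stepanov_bound (F : fieldType) (p s : nat) (B t : F) (X : seq F) :
  p \in [pchar F] -> (4 * p <= p ^ s)%N -> B ^+ (p ^ s) = B -> uniq X ->
  (forall x, x \in X -> [/\ x != 0, x ^+ (p ^ s * p ^ s) = x
      & \sum_(i < s + s) (x ^+ (p ^ i) + B * x ^- (p ^ i)) = t]) ->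
  (p * size X <= p ^ s * p ^ s + 6 * p * p ^ s)%N.
Proof.
move=> pF; set Q := (p ^ s)%N => leQ BQ uX Xt.
have pr := pcharf_prime pF; have p1 := prime_gt1 pr.
have s0 : (0 < s)%N by case: (posnP s) leQ => // s0; rewrite /Q s0; lia.
pose w := (p ^ s.-1)%N.
have Qw : Q = (p * w)%N by rewrite -expnS prednK.
have w0 : (0 < w)%N by rewrite expn_gt0 ltnW.
pose D := (Q * w)%N; pose m := (Q - 2 * p)%N.
pose hh : {poly F} := trace_poly p s B.
have [shh mhh] : size hh = (2 * w).+1 /\ hh \is monic by exact: size_trace_poly.
(* With [h = hh / X^w], every [x] in [X] satisfies [h(x)^Q = t - h(x)], so that
   [P r (x)^Q = u * R r (x)] with [u] independent of [r]. Hence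
   [G = \sum_r a_r (P r)^Q] vanishes to order [m] on [X] as soon as the
   polynomials [\sum_r a_r^`N(k) R r], [k < m], are zero: these are
   [m (D + 2 Q) < Q D] linear conditions on the coefficients of the [a_r].
   [G != 0] since the degrees of [(P r)^Q] increase by [D] with [r]. *)
pose P (r : nat) : {poly F} := 'X^(Q * (r %/ p)) * hh ^+ (r %% p) * 'X^(w * (p.-1 - r %% p)).
pose R (r : nat) : {poly F} :=
  'X^(r %/ p) * (t *: 'X^w - hh) ^+ (r %% p) * 'X^(w * (p.-1 - r %% p)).
pose f (A : 'M[F]_(Q, D)) : 'M[F]_(m, D + 2 * Q) :=
  \matrix_(k, c) (\sum_(r < Q) (rVpoly (row r A))^`N(k) * R r : {poly F})`_c.
have linf : linear f.
  move=> c A A'; apply/matrixP => k l; rewrite !mxE -coefZ -coefD; congr (_`_l).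
  under eq_bigr => r _ do rewrite !linearP /= mulrDl -scalerAl.
  by rewrite big_split /= -scaler_sumr.
have [] := linear_ker_neq0 linf.
  (* The choice [m = Q - 2 * p] is made for this count: since [Q = p * w], one has
     [m * (D + 2 * Q) = Q * (D - 4 * p)]. *)
  rewrite /m /D Qw; move: leQ; rewrite Qw; nia.
move=> A A0 fA.
pose a (r : nat) : {poly F} := if insub r is Some i then rVpoly (row i A) else 0.
have aE (r : 'I_Q) : a r = rVpoly (row r A) by rewrite /a valK.
have sa r : (size (a r) <= D)%N.
  by rewrite /a; case: insubP => [i _ _|_]; rewrite ?size_poly0 // size_poly.
have modp_le r : (r %% p <= p.-1)%N by rewrite -ltnS prednK ?ltn_pmod ?prime_gt0.
have sR (r : nat) : (r < Q)%N -> (size (R r) <= w + 2 * w * p.-1)%N.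
  move=> rQ; have rw : (r %/ p < w)%N by rewrite ltn_divLR ?prime_gt0 // mulnC -Qw.
  have sth : (size (t *: 'X^w - hh)%R <= (2 * w).+1)%N.
    rewrite (leq_trans (size_polyD _ _)) // geq_max size_polyN shh leqnn andbT.
    by rewrite (leq_trans (size_scale_leq _ _)) // size_polyXn; lia.
  apply: (leq_trans (n := (r %/ p + 2 * w * (r %% p) + w * (p.-1 - r %% p)).+1)).
    apply: size_poly_mul_leq; last by rewrite size_polyXn.
    by apply: size_poly_mul_leq; [rewrite size_polyXn | exact: size_poly_expn_leq].
  have := modp_le r; nia.
have Rzero (k : nat) : (k < m)%N -> \sum_(r < Q) (a r)^`N(k) * R r = 0.
  move=> km; apply/polyP => l; rewrite coef0.
  have [lt_l|le_l] := ltnP l (D + 2 * Q); last first.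
    apply: nth_default; apply: leq_trans le_l.
    apply: (leq_trans (size_sum _ _ _)); apply/bigmax_leqP => r _.
    apply: (leq_trans (size_polyMleq _ _)).
    have := sR r (ltn_ord r).
    have : (size (a r)^`N(k) <= D)%N.
      by apply: leq_trans (sa r); rewrite (leq_trans (size_poly _ _)) // leq_subr.
    have : (w + 2 * w * p.-1 <= 2 * Q)%N.
      by rewrite Qw; clear -p1; case: p p1 w => [|p'] //= _ w'; rewrite mulSn; nia.
    lia.
  have := congr1 (fun N : 'M[F]_(m, D + 2 * Q) => N (Ordinal km) (Ordinal lt_l)) fA.
  by rewrite !mxE /= => fAkl; rewrite -[RHS]fAkl; under eq_bigr do rewrite aE.
(* With r = p i + j and Q = p w, the exponents add up to Q i + 2 w j + w (p - 1 - j) = w (r + p -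
   1). The Q-th power turns the step w into D. *)
have sP r : size (P r ^+ Q) = (D * r + D * p.-1).+1.
  have -> : (D * r + D * p.-1 = (Q * (r %/ p) + 2 * w * (r %% p) + w * (p.-1 - r %% p)) * Q)%N.
    have jE : (p.-1 = r %% p + (p.-1 - r %% p))%N by rewrite subnKC.
    have iQQ : (r %/ p * (Q * Q) = r %/ p * (Q * (p * w)))%N by rewrite -Qw.
    rewrite [in LHS](divn_eq r p) [in X in (_ + X)%N]jE /D; lia.
  apply: size_poly_expn_eq; apply: size_poly_mul_eq; last by rewrite size_polyXn.
  by apply: size_poly_mul_eq; [rewrite size_polyXn | exact: size_poly_expn_eq].
pose G : {poly F} := \sum_(r < Q) a r * P r ^+ Q.
have G0 : G != 0.
  apply: (sum_staggered_neq0 sP sa).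
  have [r ar|A_0] := pickP (fun r => row r A != 0).
    exists r => //; rewrite aE; apply: contraNneq ar => rA0.
    by rewrite -[row r A]rVpolyK rA0 linear0.
  case/eqP: A0; apply/row_matrixP => r; rewrite row0.
  by have /negbFE/eqP := A_0 r.
have sG : (size G <= D * Q + D * p.-1)%N by exact: (size_sum_staggered Q sP sa).
have : (m * size X < size G)%N.
  apply: size_multiple_roots => // x xX; have [x0 xQ xt] := Xt x xX.
  pose u := x ^+ (w * (Q.-1 * p.-1)).
  pose h := \sum_(i < s) (x ^+ (p ^ i) + B * x ^- (p ^ i)).
  (* The sum over [s + s] indices splits into [h] and its Q-th power, since Frobenius is additive
     and fixes [B] after [s] iterations. *)
  have hQ : h ^+ Q = t - h.
    rewrite -xt big_split_ord /= -/h [h + _]addrC addrK expr_sum_pchar //;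
    apply: eq_bigr => i _ /=.
    by rewrite exprD_pchar // exprMn BQ -!exprVn -!exprM -expnD addnC.
  have hx : hh.[x] = x ^+ w * h by exact: horner_trace_poly.
  have PR r : (P r).[x] ^+ Q = u * (R r).[x].
    rewrite /P /R !hornerM !hornerXn !horner_exp hornerD hornerN hornerZ hornerXn.
    set c := x ^+ w; set i := (r %/ p)%N; set j := (r %% p)%N.
    have cQ : c ^+ Q = c ^+ Q.-1 * c by rewrite -exprSr prednK ?expn_gt0 ?prime_gt0.
    have hhQ : hh.[x] ^+ Q = c ^+ Q.-1 * (t * c - hh.[x]).
      by rewrite hx -/c exprMn hQ cQ; ring.
    have xQi : (x ^+ (Q * i)) ^+ Q = x ^+ i by rewrite -exprM mulnAC exprM xQ.
    have jE : p.-1 = (j + (p.-1 - j))%N by rewrite subnKC ?modp_le.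
    have cjQ : (x ^+ (w * (p.-1 - j))) ^+ Q = (c ^+ Q.-1 * c) ^+ (p.-1 - j).
      by rewrite -cQ exprM exprAC.
    have uE : u = (c ^+ Q.-1) ^+ j * (c ^+ Q.-1) ^+ (p.-1 - j).
      by rewrite -exprD -jE -exprM /c -exprM.
    rewrite !exprMn xQi [(hh.[x] ^+ j) ^+ Q]exprAC hhQ cjQ !exprMn uE [x ^+ (w * _)]exprM -/c.
    ring.
  (* Subtracting the constant P r (x) makes each Q-th power divisible by (X - x)^Q. What remains is
     a combination of the [a r] whose divided derivatives at [x], up to order m - 1, are values of
     the polynomials that vanish by [Rzero]. *)
  have -> : G = \sum_(r < Q) a r * (P r - ((P r).[x])%:P) ^+ Q +
      u *: \sum_(r < Q) (R r).[x] *: a r.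
    rewrite scaler_sumr -big_split /G; apply: eq_bigr => r _.
    rewrite exprB_pchar; last by rewrite pchar_poly.
    by rewrite -polyC_exp PR scalerA -mul_polyC /= mulrBr -[X in _ - X + _]mulrC subrK.
  apply: dvdp_add.
    apply: (big_ind (fun u => _ %| u)) => [|v v'|r _]; [exact: dvdp0|exact: dvdp_add|].
    apply: dvdp_mull; apply: (dvdp_trans (dvdp_exp2l _ (leq_subr _ _))).
    by apply: dvdp_exp2r; rewrite dvdp_XsubCl /root hornerD hornerN hornerC subrr.
  have u0 : u != 0 by rewrite expf_neq0.
  rewrite dvdpZr //; apply: dvdp_XsubC_exp_nderivn => k km.
  have /(congr1 (horner^~ x)) := Rzero k km; rewrite horner0 horner_sum => <-.
  rewrite linear_sum horner_sum; apply: eq_bigr => r _.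
  by rewrite [X in X.[x]]nderivnZ hornerZ [RHS]hornerM mulrC.
have pD : (p * D = Q * Q)%N by rewrite /D mulnCA -Qw.
move=> /leq_trans/(_ sG) lt_mX; rewrite leqNgt; apply/negP => gtX.
have : (p * (m * size X) < p * (D * Q + D * p.-1))%N by rewrite ltn_pmul2l ?prime_gt0.
have -> : (p * (D * Q + D * p.-1) = Q * Q * (Q + p.-1))%N by rewrite -pD; ring.
(* The constant 6 suffices because (Q - 2 p) (Q + 6 p) - Q (Q + p - 1) = (3 p + 1) Q - 12 p^2 is
   positive when 4 p <= Q. *)
have mE : Q = (m + 2 * p)%N by rewrite /m; lia.
have : (m * (Q * Q + 6 * p * Q) <= m * (p * size X))%N by rewrite leq_mul2l ltnW ?orbT.
clearbody m; move: leQ; clear -p1 mE; nia.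
Qed.

(** * The L-function of a Kloosterman sum *)

(** Indexing the monic polynomials of degree [d] by their lower coefficients turns sums over them
    into sums over a finite type. *)
Definition poly_of_rV (R : nzRingType) (d : nat) (v : 'rV[R]_d) : {poly R} :=
  'X^d + rVpoly v.

Lemma size_poly_of_rV (R : nzRingType) (d : nat) (v : 'rV[R]_d) :
  size (poly_of_rV v) = d.+1.
Proof. by rewrite size_polyDl size_polyXn // ltnS size_poly. Qed.

Lemma monic_poly_of_rV (R : nzRingType) (d : nat) (v : 'rV[R]_d) :
  poly_of_rV v \is monic.
Proof.
by rewrite monicE lead_coefDl ?lead_coefXn // size_polyXn ltnS size_poly.
Qed.

Lemma monic_size_subXn (R : nzRingType) (d : nat) (g : {poly R}) :
  g \is monic -> size g = d.+1 -> (size (g - 'X^d)%R <= d)%N.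
Proof.
move=> mg sg; apply/leq_sizeP => j; rewrite leq_eqVlt coefB coefXn => /predU1P[<-|ltj].
  by move: mg; rewrite monicE lead_coefE sg eqxx /= => /eqP->; rewrite subrr.
by rewrite nth_default ?sg // gtn_eqF // subrr.
Qed.

Definition rV_of_poly (R : nzRingType) (d : nat) (g : {poly R}) : 'rV[R]_d :=
  poly_rV (g - 'X^d).

Lemma rV_of_polyK (R : nzRingType) (d : nat) (g : {poly R}) :
  g \is monic -> size g = d.+1 -> poly_of_rV (rV_of_poly d g) = g.
Proof.
move=> mg sg; rewrite /poly_of_rV poly_rV_K ?monic_size_subXn //.
by rewrite addrC subrK.
Qed.

Lemma poly_of_rVK (R : nzRingType) (d : nat) (v : 'rV[R]_d) :
  rV_of_poly d (poly_of_rV v) = v.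
Proof. by rewrite /rV_of_poly /poly_of_rV [X in X - _]addrC addrK rVpolyK. Qed.

Lemma sum_dvdp_poly_of_rV (F : finFieldType) (V : nmodType) (f : {poly F} -> V)
    (c : {poly F}) (d e : nat) :
  c \is monic -> size c = e.+1 -> (e <= d)%N ->
  \sum_(v : 'rV[F]_d | c %| poly_of_rV v) f (poly_of_rV v) =
  \sum_(w : 'rV[F]_(d - e)) f (c * poly_of_rV w).
Proof.
move=> mc sc le_ed.
have mcw (w : 'rV[F]_(d - e)) : c * poly_of_rV w \is monic.
  by rewrite monicMl ?monic_poly_of_rV.
have scw (w : 'rV[F]_(d - e)) : size (c * poly_of_rV w) = d.+1.
  by rewrite (size_poly_mul_eq sc (size_poly_of_rV w)) subnKC.
rewrite (reindex_onto (fun w => rV_of_poly d (c * poly_of_rV w))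
  (fun v => rV_of_poly (d - e) (poly_of_rV v %/ c))) /=.
  apply: eq_big => [w|w _]; rewrite rV_of_polyK //.
  by rewrite dvdp_mulr //= mulrC mulpK ?monic_neq0 // poly_of_rVK eqxx.
move=> v cv; rewrite rV_of_polyK ?[c * _]mulrC ?divpK ?poly_of_rVK //.
  by rewrite -(monicMr _ mc) divpK // monic_poly_of_rV.
by rewrite size_divp ?monic_neq0 // size_poly_of_rV sc subSn.
Qed.

(* The shift by ['X] makes this [0], not the leading coefficient, on constants. *)
Definition subleading (R : nzRingType) (g : {poly R}) : R := ('X * g)`_(size g).-1.

(** Value at 0 of the logarithmic derivative g' / g: it is additive on products and equals minus the
    sum of the inverses of the roots. *)
Definition dlog0 (F : fieldType) (g : {poly F}) : F := g`_1 / g`_0.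

Lemma subleadingM (F : fieldType) (g h : {poly F}) : g \is monic -> h \is monic ->
  subleading (g * h) = subleading g + subleading h.
Proof.
move=> mg mh; rewrite /subleading size_monicM ?monic_neq0 //.
have [sg sh] : size g = (size g).-1.+1 /\ size h = (size h).-1.+1.
  by rewrite !prednK ?size_poly_gt0 ?monic_neq0.
set d := (size g).-1 in sg *; set e := (size h).-1 in sh *.
have su := monic_size_subXn mg sg; have sv := monic_size_subXn mh sh.
have gE : g = 'X^d + (g - 'X^d) by rewrite addrC subrK.
have hE : h = 'X^e + (h - 'X^e) by rewrite addrC subrK.
set u := g - 'X^d in su gE; set v := h - 'X^e in sv hE.
have -> : (size g + size h).-2 = (d + e)%N by rewrite sg sh addnS.
(* The last product has degree below [d + e], so at that coefficient only the two subleading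
   coefficients survive. *)
have -> : 'X * (g * h) = 'X * g * 'X^e + 'X * h * 'X^d - ('X * 'X^(d + e)) + 'X * u * v.
  by rewrite gE hE exprD; ring.
rewrite -exprS !coefD coefN !coefMXn coefXn ltnNge leq_addl addnK /=.
rewrite ltnNge leq_addr /= addKn (ltn_eqF (ltnSn _)).
rewrite subr0 [X in _ + X]nth_default ?addr0 //.
have [->|u0] := eqVneq u 0; first by rewrite mulr0 mul0r size_poly0.
have [->|v0] := eqVneq v 0; first by rewrite mulr0 size_poly0.
rewrite -mulrA size_mul ?polyX_eq0 ?mulf_neq0 // size_polyX size_mul //.
move: u0 v0; rewrite -!size_poly_gt0; clearbody d e; clear -su sv.
by move: (size u) (size v) su sv => *; lia.
Qed.

Lemma dlog0M (F : fieldType) (g h : {poly F}) : g`_0 != 0 -> h`_0 != 0 ->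
  dlog0 (g * h) = dlog0 g + dlog0 h.
Proof.
move=> g0 h0; rewrite /dlog0 coef0M coefM !big_ord_recl big_ord0 /= /bump /=.
by field; rewrite g0 h0.
Qed.

Lemma subleading_prod_XsubC (F : fieldType) (I : Type) (r : seq I) (f : I -> F) :
  subleading (\prod_(i <- r) ('X - (f i)%:P)) = - \sum_(i <- r) f i.
Proof.
elim: r => [|i r IHr].
  by rewrite !big_nil /subleading size_poly1 mulr1 coefX oppr0.
rewrite !big_cons subleadingM ?monicXsubC ?monic_prod_XsubC // IHr opprD.
by congr (_ + _); rewrite /subleading size_XsubC coefXM coefB coefX coefC sub0r.
Qed.

Lemma coef0_prod_XsubC (F : fieldType) (I : Type) (r : seq I) (f : I -> F) :
  (forall i, f i != 0) -> (\prod_(i <- r) ('X - (f i)%:P))`_0 != 0.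
Proof.
move=> f0; rewrite -horner_coef0 horner_prod; elim: r => [|i r IHr].
  by rewrite big_nil oner_eq0.
by rewrite big_cons mulf_neq0 // hornerXsubC sub0r oppr_eq0.
Qed.

Lemma dlog0_prod_XsubC (F : fieldType) (I : Type) (r : seq I) (f : I -> F) :
  (forall i, f i != 0) ->
  dlog0 (\prod_(i <- r) ('X - (f i)%:P)) = - \sum_(i <- r) (f i)^-1.
Proof.
move=> f0; elim: r => [|i r IHr].
  by rewrite !big_nil /dlog0 coef1 mul0r oppr0.
rewrite !big_cons dlog0M ?coef0_prod_XsubC ?IHr ?opprD //.
  by congr (_ + _); rewrite /dlog0 !coefB !coefX !coefC /= subr0 sub0r mul1r invrN.
by rewrite coefB coefX coefC sub0r oppr_eq0.
Qed.

Lemma subleading_map (F K : fieldType) (f : {rmorphism F -> K}) (g : {poly F}) :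
  subleading (map_poly f g) = f (subleading g).
Proof. by rewrite /subleading size_map_poly -[X in X * _](map_polyX f) -rmorphM coef_map. Qed.

Lemma dlog0_map (F K : fieldType) (f : {rmorphism F -> K}) (g : {poly F}) :
  dlog0 (map_poly f g) = f (dlog0 g).
Proof. by rewrite /dlog0 !coef_map fmorph_div. Qed.

(** * Frobenius orbits and characteristic polynomials *)

Section FrobeniusOrbits.

Variables (p : nat) (M : finFieldType) (iota : {rmorphism 'F_p -> M}).
Hypothesis pr_p : prime p.

Local Notation frob := (fun x : M => x ^+ p).

Lemma pchar_ext : p \in [pchar M].
Proof. by rewrite (fmorph_pchar iota) pchar_Fp. Qed.

Lemma iota_expp (c : 'F_p) : iota c ^+ p = iota c.
Proof. by have := expf_card c; rewrite card_Fp // -rmorphXn => ->. Qed.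

(** X^p - X is the product of the X - c over ['F_p], so each of its roots in [M] is the image of
    some c. *)
Lemma fixed_frobenius (x : M) : x ^+ p = x -> exists c, x = iota c.
Proof.
move=> xp; have := congr1 (map_poly iota) (finField_genPoly 'F_p).
rewrite card_Fp // rmorphB /= map_polyXn map_polyX rmorph_prod.
move/(congr1 (horner^~ x)); rewrite hornerD hornerN hornerXn hornerX xp subrr.
move/esym/eqP; rewrite horner_prod => /prodf_eq0[c _].
rewrite rmorphB /= map_polyX map_polyC hornerXsubC subr_eq0 => /eqP->.
by exists c.
Qed.

Definition descend (x : M) : 'F_p := odflt 0 [pick c | iota c == x].

Lemma iotaK : cancel iota descend.
Proof.
move=> c; rewrite /descend; case: pickP => [c' /eqP/fmorph_inj //|/(_ c)].
by rewrite eqxx.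
Qed.

Lemma descendK (x : M) : x ^+ p = x -> iota (descend x) = x.
Proof. by case/fixed_frobenius=> c ->; rewrite iotaK. Qed.

Definition frob_prod (e : nat) (x : M) : {poly M} :=
  \prod_(i < e) ('X - (x ^+ (p ^ i))%:P).

(** For [x] in the field with p^e elements this is its characteristic polynomial over ['F_p]: the
    minimal polynomial, raised to a power when [x] has degree less than [e]. *)
Definition frob_min (e : nat) (x : M) : {poly 'F_p} := map_poly descend (frob_prod e x).

(** Frobenius permutes the factors cyclically, because it sends the last conjugate back to [x]. *)
Lemma coef_frob_prod (e : nat) (x : M) (k : nat) : x ^+ (p ^ e) = x ->
  (frob_prod e x)`_k ^+ p = (frob_prod e x)`_k.
Proof.
move=> xe; rewrite -[_ ^+ p](pFrobenius_autE pchar_ext) -coef_map; congr (_`_k).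
rewrite rmorph_prod /frob_prod.
under eq_bigr => i _.
  rewrite rmorphB /= map_polyX map_polyC /= pFrobenius_autE -exprM -expnSr.
  over.
case: e xe => [|e] xe; first by rewrite !big_ord0.
by rewrite big_ord_recr big_ord_recl /= xe expn0 expr1 mulrC.
Qed.

Lemma map_frob_min (e : nat) (x : M) : x ^+ (p ^ e) = x ->
  map_poly iota (frob_min e x) = frob_prod e x.
Proof.
move=> xe; apply/polyP => k; rewrite coef_map /= coef_map_id0.
  by rewrite descendK // coef_frob_prod.
by rewrite -[in LHS](rmorph0 iota) iotaK.
Qed.

Lemma monic_frob_prod (e : nat) (x : M) : frob_prod e x \is monic.
Proof. exact: monic_prod_XsubC. Qed.

Lemma size_frob_prod (e : nat) (x : M) : size (frob_prod e x) = e.+1.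
Proof. by rewrite size_prod_XsubC /index_enum -enumT size_enum_ord. Qed.

Lemma monic_frob_min (e : nat) (x : M) : x ^+ (p ^ e) = x -> frob_min e x \is monic.
Proof. by move=> xe; rewrite -(map_monic iota) map_frob_min ?monic_frob_prod. Qed.

Lemma size_frob_min (e : nat) (x : M) : x ^+ (p ^ e) = x -> size (frob_min e x) = e.+1.
Proof. by move=> xe; rewrite -(size_map_poly iota) map_frob_min ?size_frob_prod. Qed.

Lemma frob_inj : injective frob.
Proof. by move=> x y; rewrite -!(pFrobenius_autE pchar_ext) => /fmorph_inj. Qed.

Lemma iter_frob (e : nat) (x : M) : iter e frob x = x ^+ (p ^ e).
Proof. by elim: e => [|e /= ->]; rewrite ?expn0 // -exprM -expnSr. Qed.

Lemma iter_order_mod (T : finType) (f : T -> T) (x : T) (e : nat) :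
  injective f -> iter e f x = iter (e %% order f x) f x.
Proof.
move=> f_inj; rewrite [in LHS](divn_eq e (order f x))  addnC iterD; congr (iter _ _ _).
by elim: (e %/ _)%N => // k IHk; rewrite mulSn iterD IHk iter_order.
Qed.

Lemma iter_eq_order (T : finType) (f : T -> T) (x : T) (e : nat) :
  injective f -> (iter e f x == x) = (order f x %| e)%N.
Proof.
move=> f_inj; rewrite iter_order_mod // /dvdn.
have lt_e : (e %% order f x < order f x)%N by rewrite ltn_mod order_gt0.
apply/eqP/eqP => [ex|-> //].
by rewrite -(findex_iter lt_e) ex findex0.
Qed.

Lemma frob_fixed (e : nat) (x : M) : (x ^+ (p ^ e) == x) = (order frob x %| e)%N.
Proof. by rewrite -iter_frob iter_eq_order //; apply: frob_inj. Qed.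

Lemma XsubC_exp_dvdp_frob (g : {poly 'F_p}) (x : M) (n : nat) :
  (('X - (x ^+ p)%:P) ^+ n %| map_poly iota g) = (('X - x%:P) ^+ n %| map_poly iota g).
Proof.
rewrite -[RHS](dvdp_map (pFrobenius_aut pchar_ext)) [map_poly _ (_ ^+ _)]rmorphXn /= rmorphB /=.
rewrite map_polyX map_polyC /= pFrobenius_autE; congr (_ %| _).
apply/polyP => k; rewrite !coef_map /=.
exact/esym/iota_expp.
Qed.

Lemma XsubC_exp_dvdp_iter_frob (g : {poly 'F_p}) (x : M) (n i : nat) :
  (('X - (x ^+ (p ^ i))%:P) ^+ n %| map_poly iota g) =
  (('X - x%:P) ^+ n %| map_poly iota g).
Proof. by elim: i => [|i IHi]; rewrite ?expr1 // expnSr exprM XsubC_exp_dvdp_frob. Qed.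

(** Since [g] has coefficients in the prime field, all conjugates of [x] have the same multiplicity
    in it, and the orbit lists each conjugate once. *)
Lemma frob_prod_order_dvdp (g : {poly 'F_p}) (x : M) (k : nat) :
  (frob_prod (order frob x) x ^+ k %| map_poly iota g) =
  (('X - x%:P) ^+ k %| map_poly iota g).
Proof.
apply/idP/idP => [|dvdx].
  apply: dvdp_trans; apply: dvdp_exp2r.
  rewrite /frob_prod -(prednK (order_gt0 _ _)) big_ord_recl expr1.
  exact: dvdp_mulIl.
have -> : frob_prod (order frob x) x = \prod_(y <- orbit frob x) ('X - y%:P).
  rewrite /orbit; elim: (order _ _) => [|e IHe]; first by rewrite /frob_prod big_ord0 big_nil.
  by rewrite trajectSr big_rcons /= -IHe /frob_prod big_ord_recr iter_frob.
apply: prod_XsubC_exp_dvdp => [|_ /trajectP[i _ ->]]; first exact: orbit_uniq.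
by rewrite iter_frob XsubC_exp_dvdp_iter_frob.
Qed.

Lemma frob_prod_mul (k : nat) (x : M) :
  frob_prod (k * order frob x) x = frob_prod (order frob x) x ^+ k.
Proof.
elim: k => [|k IHk]; first by rewrite /frob_prod big_ord0 expr0.
rewrite mulSn exprS -IHk /frob_prod big_split_ord /=; congr (_ * _).
apply: eq_bigr => i _; rewrite expnD exprM.
by have /eqP-> : x ^+ (p ^ order frob x) == x by rewrite frob_fixed.
Qed.

(* [frob_prod (k * r) x] is the [k]-th power of the minimal polynomial of [x],
   of degree [r]; this replaces unique factorization over ['F_p]. *)
Lemma sum_frob_prod_dvdp (g : {poly 'F_p}) (d : nat) (x : M) :
  g \is monic -> size g = d.+1 ->
  (\sum_(1 <= e < d.+1 | (x ^+ (p ^ e) == x)%R &&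
    (frob_prod e x %| map_poly iota g)%R) 1 = mup x (map_poly iota g))%N.
Proof.
move=> mg sg; set gM := map_poly iota g; set r := order frob x.
have r0 : (0 < r)%N by exact: order_gt0.
have gM0 : gM != 0 by rewrite monic_neq0 // map_monic.
have le_mr : (mup x gM * r <= d)%N.
  have : frob_prod (mup x gM * r) x %| gM.
    by rewrite frob_prod_mul frob_prod_order_dvdp -mup_geq.
  by move/(dvdp_leq gM0); rewrite size_frob_prod size_map_poly sg ltnS.
(* The exponents to be counted are the multiples of [r] up to [mup x gM * r]. *)
rewrite -[RHS](mulnK _ r0) divn_count_dvd.
have -> : (\sum_(1 <= e < (mup x gM * r).+1) (r %| e) =
    \sum_(1 <= e < (mup x gM * r).+1 | r %| e) 1)%N.
  by rewrite [RHS]big_mkcond; apply: eq_bigr => e _; case: (r %| e)%N.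
rewrite [RHS](big_nat_widen _ _ d.+1) //; apply: eq_bigl => e.
rewrite frob_fixed -/r; apply: andb_id2l => /divnK <-.
by rewrite frob_prod_mul frob_prod_order_dvdp -mup_geq // ltnS leq_pmul2r.
Qed.

(** * The character on monic polynomials and its L-function *)

Variables (psi : 'F_p -> algC) (b : 'F_p).
Hypothesis psiD : forall u v, psi (u + v) = psi u * psi v.
Hypothesis psi0 : psi 0 = 1.

(** The value 0 at polynomials vanishing at 0 keeps multiplicativity. On X - c with c nonzero this
    is the Kloosterman term psi (c + b / c). *)
Definition kloos_char (g : {poly 'F_p}) : algC :=
  if g`_0 == 0 then 0 else psi (- subleading g - b * dlog0 g).

Lemma kloos_charM (g h : {poly 'F_p}) : g \is monic -> h \is monic ->
  kloos_char (g * h) = kloos_char g * kloos_char h.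
Proof.
move=> mg mh; rewrite /kloos_char coef0M mulf_eq0.
have [g0|g0] /= := eqVneq g`_0 0; first by rewrite mul0r.
have [h0|h0] /= := eqVneq h`_0 0; first by rewrite mulr0.
rewrite subleadingM // dlog0M // -psiD; congr (psi _); ring.
Qed.

(** For e > 0, once [M] contains the field with p^e elements, this is the Kloosterman sum over that
    field: [psi] is applied to the trace of x + b / x, and x = 0 contributes 0. *)
Definition kloos_sum (e : nat) : algC :=
  \sum_(x : M | x ^+ (p ^ e) == x) kloos_char (frob_min e x).

(** Coefficient of T^d in the L-function of [kloos_char]. *)
Definition kloos_poly_sum (d : nat) : algC :=
  \sum_(v : 'rV['F_p]_d) kloos_char (poly_of_rV v).

Lemma iota_trace (e : nat) (x : M) : x != 0 -> x ^+ (p ^ e) = x ->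
  iota (- subleading (frob_min e x) - b * dlog0 (frob_min e x)) =
  \sum_(i < e) (x ^+ (p ^ i) + iota b * x ^- (p ^ i)).
Proof.
move=> x0 xe; have xi0 (i : 'I_e) : x ^+ (p ^ i) != 0 by rewrite expf_neq0.
rewrite rmorphB rmorphN rmorphM /= -subleading_map -dlog0_map map_frob_min //.
rewrite subleading_prod_XsubC dlog0_prod_XsubC // big_split /= -mulr_sumr; ring.
Qed.

Lemma kloos_char_frob_min (e : nat) (x : M) : x != 0 -> x ^+ (p ^ e) = x ->
  kloos_char (frob_min e x) =
  psi (descend (\sum_(i < e) (x ^+ (p ^ i) + iota b * x ^- (p ^ i)))).
Proof.
move=> x0 xe; have xi0 (i : 'I_e) : x ^+ (p ^ i) != 0 by rewrite expf_neq0.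
have := coef0_prod_XsubC (index_enum 'I_e) xi0.
rewrite -/(frob_prod e x) -map_frob_min // coef_map fmorph_eq0 /kloos_char.
by move/negPf->; rewrite -iota_trace // iotaK.
Qed.

(** The coefficient of T^d in T L' = L S, with S the generating series of the [kloos_sum e]. The
    roots of each polynomial are counted by multiplicity, each multiplicity counts the [e] for which
    [frob_min e x] is a divisor, and multiplicativity splits that divisor off. *)
Lemma kloos_newton (d : nat) :
  (forall v : 'rV['F_p]_d, \sum_(x : M) mup x (map_poly iota (poly_of_rV v)) = d)%N ->
  d%:R * kloos_poly_sum d =
  \sum_(1 <= e < d.+1) kloos_sum e * kloos_poly_sum (d - e).
Proof.
move=> split_d; rewrite /kloos_poly_sum mulr_sumr.
under eq_bigr => v _.
  rewrite -{1}(split_d v) natr_sum mulr_suml.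
  under eq_bigr => x _.
    rewrite -(sum_frob_prod_dvdp _ (monic_poly_of_rV v) (size_poly_of_rV v)).
    rewrite natr_sum mulr_suml big_mkcond /=.
    over.
  rewrite exchange_big /=; over.
rewrite exchange_big /=; apply: eq_big_nat => e /andP[e1 led].
rewrite exchange_big mulr_suml [RHS]big_mkcond; apply: eq_bigr => x _ /=.
have [xe|_] /= := eqVneq (x ^+ (p ^ e)) x; last by rewrite big1.
transitivity (\sum_(v : 'rV['F_p]_d | frob_min e x %| poly_of_rV v)
    kloos_char (poly_of_rV v)).
  rewrite [RHS]big_mkcond; apply: eq_bigr => v _.
  by rewrite -(dvdp_map iota) map_frob_min // mul1r.
rewrite (sum_dvdp_poly_of_rV _ (monic_frob_min xe) (size_frob_min xe)) //.
rewrite mulr_sumr; apply: eq_bigr => w _.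
by rewrite kloos_charM ?monic_frob_min ?monic_poly_of_rV.
Qed.

Hypothesis b_neq0 : b != 0.
Hypothesis psi_neq1 : exists u, psi u != 1.

Lemma mulr_neq1_eq0 (F : fieldType) (x c : F) : c != 1 -> x * c = x -> x = 0.
Proof.
move=> c1 /eqP; rewrite -subr_eq0 -{2}[x]mulr1 -mulrBr mulf_eq0 subr_eq0.
by rewrite (negPf c1) orbF => /eqP.
Qed.

Lemma sum_psiM (u : 'F_p) : \sum_x psi (u * x) = if u == 0 then p%:R else 0.
Proof.
have [->|u0] := eqVneq u 0.
  under eq_bigr do rewrite mul0r psi0.
  by rewrite sumr_const card_Fp.
have [t t1] := psi_neq1; apply: (mulr_neq1_eq0 t1).
rewrite mulr_suml [RHS](reindex_inj (addrI (t / u))) /=.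
by apply: eq_bigr => x _; rewrite mulrDr psiD mulrCA divff // mulr1 mulrC.
Qed.

Lemma coef_poly_of_rV (d : nat) (v : 'rV['F_p]_d) (i : 'I_d) :
  (poly_of_rV v)`_i = v 0 i.
Proof. by rewrite coefD coefXn ltn_eqF // add0r coef_rVpoly_ord. Qed.

Lemma subleading_poly_of_rV (d : nat) (v : 'rV['F_p]_d.+1) :
  subleading (poly_of_rV v) = v 0 ord_max.
Proof. by rewrite /subleading size_poly_of_rV coefXM /= -coef_poly_of_rV. Qed.

Definition kloosterman : algC := \sum_(x | x != 0) psi (x + b / x).

Lemma kloos_poly_sum0 : kloos_poly_sum 0 = 1.
Proof.
rewrite /kloos_poly_sum (big_pred1 0) => [|v]; last by rewrite /= (thinmx0 v) eqxx.
rewrite /poly_of_rV linear0 addr0 expr0 /kloos_char coef1 oner_eq0 /subleading.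
rewrite /dlog0 size_poly1 mulr1 coefX coef1 /= mul0r mulr0 subr0 oppr0.
exact: psi0.
Qed.

Lemma kloos_poly_sum1 : kloos_poly_sum 1 = kloosterman.
Proof.
pose h (c : 'F_p) : 'rV['F_p]_1 := \row__ - c.
rewrite /kloos_poly_sum (reindex h) /=; last first.
  exists (fun v : 'rV_1 => - v 0 0) => [c _|v _]; first by rewrite mxE opprK.
  by apply/rowP => i; rewrite mxE opprK ord1.
rewrite /kloosterman [RHS]big_mkcond; apply: eq_bigr => c _ /=.
rewrite /kloos_char /dlog0 subleading_poly_of_rV.
have -> : (poly_of_rV (h c))`_0 = - c by rewrite -[0%N]/(val (0 : 'I_1)) coef_poly_of_rV mxE.
have -> : (poly_of_rV (h c))`_1 = 1.
  have := monic_poly_of_rV (h c); rewrite monicE lead_coefE size_poly_of_rV.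
  by move/eqP.
rewrite oppr_eq0 mxE opprK div1r invrN mulrN opprK.
by case: eqP.
Qed.

(** On X^2 + x X + c with c nonzero the argument of [psi] is - (1 + b / c) x. Summing over x gives
    0, except for c = - b, which gives p. *)
Lemma kloos_poly_sum2 : kloos_poly_sum 2 = p%:R.
Proof.
pose h (c : 'F_p * 'F_p) : 'rV['F_p]_2 := \row_i (if i == 0 then c.1 else c.2).
rewrite /kloos_poly_sum (reindex h) /=; last first.
  exists (fun v : 'rV_2 => (v 0 0, v 0 1)) => [[c c'] _|v _]; first by rewrite !mxE.
  apply/rowP => i; rewrite mxE /=; case: eqP => [->//|].
  case: i => [[|[|m]] lt_i] //= ne; first by case: ne; apply: val_inj.
  by congr (v 0 _); apply: val_inj.
rewrite -(pair_bigA _ (fun c c' => kloos_char (poly_of_rV (h (c, c'))))) /=.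
rewrite (bigD1 (- b)) //= [X in _ + X]big1 => [|c cb].
  rewrite addr0.
  transitivity (\sum_x psi (0 * x)); last by rewrite sum_psiM eqxx.
  apply: eq_bigr => x _; rewrite /kloos_char /dlog0 subleading_poly_of_rV.
  rewrite -[0%N]/(val (0 : 'I_2)) -[1%N]/(val (1 : 'I_2)) !coef_poly_of_rV !mxE /=.
  rewrite oppr_eq0 (negPf b_neq0); congr psi.
  by rewrite invrN !mulrN opprK mulrCA divff // mulr1 addNr mul0r.
have [->|c0] := eqVneq c 0.
  rewrite big1 // => x _; rewrite /kloos_char.
  by rewrite -[0%N]/(val (0 : 'I_2)) coef_poly_of_rV mxE eqxx.
transitivity (\sum_x psi (- (1 + b / c) * x)).
  apply: eq_bigr => x _; rewrite /kloos_char /dlog0 subleading_poly_of_rV.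
  rewrite -[0%N]/(val (0 : 'I_2)) -[1%N]/(val (1 : 'I_2)) !coef_poly_of_rV !mxE /=.
  rewrite (negPf c0); congr psi; field; exact: c0.
rewrite sum_psiM oppr_eq0 ifN //; apply: contraNneq cb => bc.
by rewrite -addr_eq0 -[c]mul1r -[b](divfK c0) -mulrDl bc mul0r.
Qed.

(** From degree 3 on, the subleading coefficient is distinct from those of index 0 and 1, so
    translating it multiplies the sum by a value of [psi] other than 1. *)
Lemma kloos_poly_sum_ge3 (d : nat) : (2 < d)%N -> kloos_poly_sum d = 0.
Proof.
case: d => [|[|[|d]]] // _; have [t t1] := psi_neq1.
apply: (mulr_neq1_eq0 t1); rewrite /kloos_poly_sum mulr_suml.
rewrite [RHS](reindex_inj (addrI (- t *: delta_mx 0 ord_max))) /=.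
apply: eq_bigr => v _; rewrite /kloos_char /dlog0 !subleading_poly_of_rV.
rewrite -[0%N]/(val (0 : 'I_d.+3)) -[1%N]/(val (1 : 'I_d.+3)) !coef_poly_of_rV !mxE /=.
rewrite eqxx !mulr0 !add0r mulr1; case: eqP => [_|_]; first by rewrite mul0r.
by rewrite -psiD; congr psi; ring.
Qed.

(** The L-function is 1 + K T + p T^2 = (1 - al T) (1 - be T), so [kloos_newton] becomes the
    recurrence S_d + K S_(d-1) + p S_(d-2) = 0 of the power sums. *)
Lemma kloos_sum_power (n d : nat) (al be : algC) :
  (forall k, (k <= n)%N -> forall v : 'rV['F_p]_k,
     \sum_(x : M) mup x (map_poly iota (poly_of_rV v)) = k)%N ->
  al + be = - kloosterman -> al * be = p%:R -> (0 < d <= n)%N ->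
  kloos_sum d = - (al ^+ d + be ^+ d).
Proof.
move=> split_n sum_ab prod_ab; elim/ltn_ind: d => d IHd /andP[d0 dn].
have := kloos_newton (split_n d dn).
have K1 : kloosterman = - (al + be) by rewrite sum_ab opprK.
case: d d0 dn IHd => [|[|[|d]]] // _ dn IHd.
- by rewrite big_nat1 mul1r kloos_poly_sum0 kloos_poly_sum1 mulr1 K1.
- rewrite big_nat_recr //= big_nat1 kloos_poly_sum0 kloos_poly_sum1 kloos_poly_sum2.
  rewrite IHd ?(ltnW dn) // K1 -prod_ab mulr1 => /eqP.
  rewrite eq_sym addrC -subr_eq0 => /eqP S2; apply/eqP.
  by rewrite -subr_eq0 -S2; apply/eqP; ring.
rewrite kloos_poly_sum_ge3 // mulr0 big_nat_recr //= big_nat_recr //= big_nat_recr //= subnn.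
have [-> ->] : (d.+3 - d.+1 = 2 /\ d.+3 - d.+2 = 1)%N by lia.
rewrite kloos_poly_sum0 kloos_poly_sum1 kloos_poly_sum2.
rewrite big_nat big1 => [|e /andP[e1 le_e]]; last first.
  by rewrite kloos_poly_sum_ge3 ?mulr0 //; lia.
rewrite (IHd d.+1) ?(IHd d.+2) // ?(ltnW dn) ?(ltnW (ltnW dn)) //.
rewrite K1 -prod_ab mulr1 add0r !exprS => /eqP.
rewrite eq_sym addrC -subr_eq0 => /eqP S3; apply/eqP.
by rewrite -subr_eq0 -S3; apply/eqP; ring.
Qed.

Lemma psi_norm (u : 'F_p) : `|psi u| = 1.
Proof.
have psiX k : psi (u *+ k) = psi u ^+ k.
  by elim: k => [|k IHk]; rewrite ?mulr0n ?psi0 // mulrS psiD IHk exprS.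
have p0 := prime_gt0 pr_p; apply/eqP; rewrite -(@pexpr_eq1 _ _ p) ?normr_ge0 //.
by rewrite -normrX -psiX -mulr_natr pchar_Fp_0 // mulr0 psi0 normr1.
Qed.

Lemma kloos_char_frob_min0 (e : nat) : (0 < e)%N -> kloos_char (frob_min e 0) = 0.
Proof.
move=> e0; have z_e : (0 : M) ^+ (p ^ e) = 0.
  by rewrite expr0n expn_eq0 (gtn_eqF (prime_gt0 pr_p)).
rewrite /kloos_char -(fmorph_eq0 iota) -coef_map map_frob_min //.
rewrite -horner_coef0 /frob_prod -(prednK e0) big_ord_recl expr1 hornerM.
by rewrite hornerXsubC subr0 mul0r eqxx.
Qed.

(** Stepanov's method bounds the fibres of the trace only from above. As the values of [psi] sum to
    0, p times each fibre size may be replaced by its deficit from Q^2 + 6 p Q; the deficits are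
    nonnegative with total p (6 p Q + 1). *)
Lemma kloos_sum_bound (s : nat) : (4 * p <= p ^ s)%N ->
  #|[pred x : M | x ^+ (p ^ (s + s)) == x]| = (p ^ (s + s))%N ->
  `|kloos_sum (s + s)| <= (6 * p * p ^ s + 1)%:R.
Proof.
move=> lt_s card_fix; have p0 := prime_gt0 pr_p; set Q := (p ^ s)%N.
have s0 : (0 < s)%N by case: (posnP s) lt_s => // ->; rewrite expn0; lia.
pose tr (x : M) := \sum_(i < s + s) (x ^+ (p ^ i) + iota b * x ^- (p ^ i)).
pose A t := [pred x : M | [&& x ^+ (p ^ (s + s)) == x, x != 0 & descend (tr x) == t]].
have leA t : (p * #|A t| <= Q * Q + 6 * p * Q)%N.
  rewrite cardE; apply: (stepanov_bound (B := iota b) (t := iota t)) => //.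
  - exact: pchar_ext.
  - by rewrite -iter_frob; elim: s {lt_s card_fix Q s0 tr A} => //= k ->; rewrite iota_expp.
  - exact: enum_uniq.
  move=> x; rewrite mem_enum => /and3P[/eqP xe x0 /eqP <-]; split=> //.
    by rewrite -expnD.
  by rewrite -/(tr x) /tr -(iota_trace x0 xe) iotaK.
have sumA : (\sum_t #|A t| = Q * Q - 1)%N.
  rewrite -expnD -card_fix (cardD1 0) inE expr0n expn_eq0 (gtn_eqF p0) eqxx add1n subn1 /=.
  rewrite -sum1_card (partition_big (fun x => descend (tr x)) xpredT) //=.
  apply: eq_bigr => t _; rewrite -sum1_card; apply: eq_bigl => x.
  by rewrite !inE andbA [(_ == x) && _]andbC.
have SE : kloos_sum (s + s) = \sum_t psi t * #|A t|%:R.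
  rewrite /kloos_sum (bigD1 0) /=; last by rewrite expr0n expn_eq0 (gtn_eqF p0).
  rewrite kloos_char_frob_min0 ?addn_gt0 ?s0 // add0r.
  rewrite (partition_big (fun x => descend (tr x)) xpredT) //=.
  apply: eq_bigr => t _; rewrite -sum1_card natr_sum mulr_sumr.
  apply: eq_big => [x|x /andP[/andP[/eqP xe x0] /eqP <-]]; first by rewrite !inE andbA.
  by rewrite mulr1 kloos_char_frob_min.
have p0R : 0 < p%:R :> algC by rewrite ltr0n.
rewrite -(ler_pM2l p0R) -[X in X * `|_|]ger0_norm ?ler0n // -normrM SE mulr_sumr.
have -> : \sum_t p%:R * (psi t * #|A t|%:R) =
    - \sum_t psi t * ((Q * Q + 6 * p * Q) - p * #|A t|)%:R.
  have := sum_psiM 1; rewrite oner_eq0 => sum0.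
  transitivity (\sum_t p%:R * (psi t * #|A t|%:R) -
     (Q * Q + 6 * p * Q)%:R * \sum_t psi (1 * t)); first by rewrite sum0 mulr0 subr0.
  rewrite mulr_sumr -sumrB -sumrN; apply: eq_bigr => t _.
  by rewrite natrB // mul1r natrM; ring.
rewrite normrN (le_trans (ler_norm_sum _ _ _)) //.
under eq_bigr do rewrite normrM psi_norm mul1r normr_nat.
rewrite -natr_sum -natrM ler_nat sumnB // -big_distrr /= sumA sum_nat_const card_Fp //.
by have := leA 0; nia.
Qed.

End FrobeniusOrbits.

(** * The Weil bound for Kloosterman sums *)

Lemma sum_count_mem (T : finType) (s : seq T) :
  (\sum_(x : T) count_mem x s = size s)%N.
Proof.
elim: s => [|y s IHs] /=; first by rewrite big1.
rewrite big_split /= IHs (bigD1 y) //= eqxx big1 => [|x]; first by rewrite addn0.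
by rewrite eq_sym => /negPf->.
Qed.

(** Take a splitting field of the product of X^(p^n) - X and all monic polynomials of degree at most
    [n]. The derivative of X^(p^n) - X is -1, so it has p^n distinct roots. *)
Lemma finite_splitting_field (p n : nat) : prime p -> (0 < n)%N ->
  exists (M : finFieldType) (iota : {rmorphism 'F_p -> M}),
    (forall k, (k <= n)%N -> forall v : 'rV['F_p]_k,
       \sum_(x : M) mup x (map_poly iota (poly_of_rV v)) = k)%N /\
    #|[pred x : M | x ^+ (p ^ n) == x]| = (p ^ n)%N.
Proof.
move=> pr_p n0; have p1 := prime_gt1 pr_p.
have q1 : (1 < p ^ n)%N by rewrite -(exp1n n) ltn_exp2r.
pose W : {poly 'F_p} := 'X^(p ^ n) - 'X.
have sW : size W = (p ^ n).+1.
  by rewrite size_polyDl ?size_polyXn // size_polyN size_polyX.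
have mW : W \is monic.
  by rewrite monicE lead_coefDl ?lead_coefXn // size_polyN size_polyX size_polyXn.
pose Q : {poly 'F_p} := W * \prod_(k < n.+1) \prod_(v : 'rV['F_p]_k) poly_of_rV v.
have Q0 : Q != 0.
  rewrite monic_neq0 // monicMl // monic_prod // => k _.
  by rewrite monic_prod // => v _; rewrite monic_poly_of_rV.
have [L [zs eq_zs _]] := FinSplittingFieldFor Q0.
pose M : finFieldType := finvect_type L.
pose iota : {rmorphism 'F_p -> M} := GRing.in_alg L.
have splits (g : {poly 'F_p}) : g \is monic -> g %| Q ->
    exists rs : seq M, map_poly iota g = \prod_(z <- rs) ('X - z%:P).
  move=> mg gQ; have : map_poly iota g %| \prod_(z <- zs) ('X - z%:P).
    by rewrite -(eqp_dvdr _ eq_zs) dvdp_map.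
  case/dvdp_prod_XsubC=> m; rewrite eqp_monic ?map_monic ?monic_prod_XsubC //.
  by move/eqP; exists (mask m zs).
exists M, iota; split=> [k le_kn v|].
  have dvQ : poly_of_rV v %| Q.
    have lt_kn : (k < n.+1)%N by [].
    rewrite dvdp_mull // (bigD1 (Ordinal lt_kn)) //= dvdp_mulr //.
    by rewrite (bigD1 v) //= dvdp_mulr.
  have [rs rsE] := splits _ (monic_poly_of_rV v) dvQ.
  under eq_bigr do rewrite rsE mu_prod_XsubC.
  rewrite sum_count_mem; apply/eqP; rewrite -eqSS -(size_prod_XsubC rs id) -rsE.
  by rewrite size_map_poly size_poly_of_rV.
have [rs rsE] := splits W mW (dvdp_mulr _ (dvdpp W)).
have urs : uniq rs.
  rewrite -(separable_prod_XsubC rs) -rsE separable_map.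
  rewrite unlock derivB derivXn derivX -mulr_natr.
  have -> : (p ^ n)%:R = 0 :> {poly 'F_p}.
    by rewrite natrX -polyC_natr pchar_Fp_0 // polyC0 expr0n gtn_eqF.
  by rewrite mulr0 sub0r -scaleN1r coprimepZr ?oppr_eq0 ?oner_eq0 // coprimep1.
have szrs : size rs = (p ^ n)%N.
  by apply/eqP; rewrite -eqSS -(size_prod_XsubC rs id) -rsE size_map_poly sW.
rewrite -[RHS]szrs -(card_uniqP urs); apply: eq_card => x.
rewrite inE -root_prod_XsubC -rsE rmorphB /= map_polyXn map_polyX.
by rewrite /root hornerD hornerN hornerXn hornerX subr_eq0.
Qed.

Lemma conj_psi (p : nat) (psi : 'F_p -> algC) : prime p ->
  (forall u v, psi (u + v) = psi u * psi v) -> psi 0 = 1 ->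
  forall u, (psi u)^* = psi (- u).
Proof.
move=> pr_p psiD psi0 u; have n1 := psi_norm pr_p psiD psi0 u.
have u0 : psi u != 0 by rewrite -normr_eq0 n1 oner_eq0.
apply: (mulfI u0); rewrite -psiD subrr psi0.
by rewrite -normCK n1 expr1n.
Qed.

(** The substitution x -> - x conjugates every term. *)
Lemma kloosterman_real (p : nat) (psi : 'F_p -> algC) (b : 'F_p) : prime p ->
  (forall u v, psi (u + v) = psi u * psi v) -> psi 0 = 1 ->
  kloosterman psi b \is Num.real.
Proof.
move=> pr_p psiD psi0; apply/CrealP; rewrite /kloosterman rmorph_sum /=.
rewrite [RHS](reindex_inj oppr_inj) /=; apply: eq_big => [x|x _]; first by rewrite oppr_eq0.
by rewrite (conj_psi pr_p psiD psi0) opprD invrN mulrN.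
Qed.

Lemma exp_unbounded (u c : algC) (s0 : nat) : 1 < u -> 0 <= c ->
  exists2 s, (s0 <= s)%N & c < u ^+ s.
Proof.
move=> u1 c0; have u1' : 0 < u - 1 by rewrite subr_gt0.
have bern k : 1 + k%:R * (u - 1) <= u ^+ k.
  elim: k => [|k IHk]; first by rewrite mul0r addr0 expr0.
  rewrite exprS; apply: le_trans (ler_wpM2l (ltW (lt_trans ltr01 u1)) IHk).
  rewrite -subr_ge0 -natr1.
  have -> : u * (1 + k%:R * (u - 1)) - (1 + (k%:R + 1) * (u - 1)) =
    k%:R * ((u - 1) * (u - 1)) by ring.
  by rewrite mulr_ge0 ?mulr_ge0 ?ler0n ?ltW.
pose N := Num.bound (c / (u - 1)).
exists (maxn s0 N); first exact: leq_maxl.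
apply: lt_le_trans (bern _); rewrite ltr_pwDl // -ler_pdivrMr //.
apply: (le_trans (ltW (archi_boundP _))); first by rewrite divr_ge0 // ltW.
by rewrite ler_nat leq_maxr.
Qed.

Lemma leq_mul4_expn (p s : nat) : (1 < p)%N -> (3 < s)%N -> (4 * p <= p ^ s)%N.
Proof.
move=> p1 s3; have p0 : (0 < p)%N by exact: ltnW.
have le_s : (p ^ (2 + 1) <= p ^ s)%N by rewrite leq_pexp2l // ltnW.
apply: leq_trans le_s; rewrite expnD expn1 leq_pmul2r //.
by have : (2 ^ 2 <= p ^ 2)%N by rewrite leq_exp2r.
Qed.

Theorem kloosterman_sqr_le (p : nat) (psi : 'F_p -> algC) (b : 'F_p) : prime p ->
  (forall u v, psi (u + v) = psi u * psi v) -> psi 0 = 1 ->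
  (exists u, psi u != 1) -> b != 0 ->
  kloosterman psi b ^+ 2 <= (4 * p)%:R.
Proof.
move=> pr_p psiD psi0 psi1 b0; set K := kloosterman psi b.
have p0 := prime_gt0 pr_p; have p1 := prime_gt1 pr_p.
have Kreal : K \is Num.real by exact: kloosterman_real.
have Dreal : K ^+ 2 - (4 * p)%:R \is Num.real by rewrite rpredB ?rpredX ?realn.
rewrite -subr_le0 real_leNgt ?real0 //; apply/negP => D0.
pose r := sqrtC (K ^+ 2 - (4 * p)%:R).
have r0 : 0 < r by rewrite sqrtC_gt0.
have rr : r ^+ 2 = K ^+ 2 - 4 * p%:R by rewrite sqrtCK natrM.
pose al := (- K + r) / 2; pose be := (- K - r) / 2.
have sum_ab : al + be = - K by rewrite /al /be; field.
have prod_ab : al * be = p%:R.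
  transitivity ((K ^+ 2 - r ^+ 2) / 4); first by rewrite /al /be; field.
  by rewrite rr; field.
have pR : 0 < p%:R :> algC by rewrite ltr0n.
have rreal : r \is Num.real by exact: gtr0_real.
have two_real : 2 \is @Num.real algC by exact: realn.
have al_real : al \is Num.real by rewrite rpred_div // rpredD // rpredN.
have be_real : be \is Num.real by rewrite rpred_div // rpredB // rpredN.
have al2 : 0 <= al ^+ 2 by rewrite real_exprn_even_ge0.
have be2 : 0 <= be ^+ 2 by rewrite real_exprn_even_ge0.
(* The even exponent 2 s makes both powers nonnegative, so a bound on their sum bounds each of
   them. *)
have bound s : (4 <= s)%N -> al ^+ 2 ^+ s + be ^+ 2 ^+ s <= (7 * p * p ^ s)%:R.
  move=> s4; have n0 : (0 < s + s)%N by rewrite addn_gt0 (ltnW (ltnW (ltnW s4))).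
  have [M [iota [split_n card_n]]] := finite_splitting_field pr_p n0.
  have lt_s : (4 * p <= p ^ s)%N by exact: leq_mul4_expn.
  have := kloos_sum_bound iota pr_p psiD psi0 b0 psi1 lt_s card_n.
  rewrite (kloos_sum_power pr_p psiD psi0 b0 psi1 split_n sum_ab prod_ab) ?n0 ?leqnn //.
  rewrite normrN addnn -mul2n !exprM ger0_norm; last by apply: addr_ge0; apply: exprn_ge0.
  move/le_trans; apply; rewrite ler_nat; have : (0 < p ^ s)%N by rewrite expn_gt0 p0.
  by move: (p ^ s)%N p0; clear; nia.
(* Since al be = p, the product (al^2 - p) (be^2 - p) is - p (al - be)^2 < 0. So one square exceeds
   p, and its powers outgrow 7 p p^s. *)
have [g [g2 g_bound]] : exists g : algC, p%:R < g ^+ 2 /\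
    forall s, (4 <= s)%N -> g ^+ 2 ^+ s <= (7 * p * p ^ s)%:R.
  have [al_gt|al_le] := real_ltP (realn _ p) (rpredX 2 al_real).
    exists al; split; first exact: al_gt.
    by move=> k k4; apply: le_trans (bound k k4); rewrite lerDl; apply: exprn_ge0.
  exists be; split; last first.
    by move=> k k4; apply: le_trans (bound k k4); rewrite lerDr; apply: exprn_ge0.
  rewrite real_ltNge ?realn ?rpredX //; apply/negP => be_le.
  have : 0 <= (al ^+ 2 - p%:R) * (be ^+ 2 - p%:R) by rewrite mulr_le0 ?subr_le0.
  have -> : (al ^+ 2 - p%:R) * (be ^+ 2 - p%:R) = - (p%:R * r ^+ 2).
    have -> : r = al - be by rewrite /al /be; field.
    by rewrite -prod_ab; ring.
  by rewrite oppr_ge0 lt_geF // mulr_gt0 // exprn_gt0.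
have u1 : 1 < g ^+ 2 / p%:R by rewrite ltr_pdivlMr // mul1r.
have [s s4] := exp_unbounded 4 u1 (ler0n _ (7 * p)).
rewrite expr_div_n ltr_pdivlMr ?exprn_gt0 // -natrX -natrM.
by rewrite real_ltNge ?g_bound ?realn // rpredX // ger0_real // ltW // (lt_trans pR).
Qed.

(** * Points on the modular hyperbola *)

Lemma exists_additive_char (p : nat) : prime p ->
  exists psi : 'F_p -> algC, [/\ forall u v, psi (u + v) = psi u * psi v,
    psi 0 = 1 & exists u, psi u != 1].
Proof.
move=> pr_p; have p0 := prime_gt0 pr_p; have p1 := prime_gt1 pr_p.
have [w w_prim] := C_prim_root_exists p0.
exists (fun u => w ^+ (u : nat)); split=> [u v||].
- rewrite -exprD -[RHS](prim_expr_mod w_prim); congr (_ ^+ (_ %% _)%N).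
  exact: Fp_cast.
- by rewrite expr0.
exists 1; have -> : (1 : 'F_p) = 1%N :> nat by [].
by rewrite -(prim_order_dvd w_prim) dvdn1 gtn_eqF.
Qed.

Lemma sqr_sum_le (R : numDomainType) (I : finType) (a : I -> R) :
  (forall i, a i \is Num.real) ->
  (\sum_i a i) ^+ 2 <= #|I|%:R * \sum_i a i ^+ 2.
Proof.
move=> a_real; have : 0 <= \sum_i \sum_j (a i - a j) ^+ 2.
  by do 2!apply: sumr_ge0 => ? _; rewrite real_exprn_even_ge0 // rpredB.
have -> : \sum_i \sum_j (a i - a j) ^+ 2 =
    (#|I|%:R * \sum_i a i ^+ 2 - (\sum_i a i) ^+ 2) *+ 2.
  under eq_bigr => i _.
    under eq_bigr do rewrite sqrrB.
    rewrite !big_split /= sumr_const sumrN sumrMnl -mulr_sumr -mulr_natl; over.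
  rewrite !big_split /= -mulr_sumr sumrN sumrMnl -mulr_suml sumr_const -mulr_natl.
  by ring.
by rewrite pmulrn_lge0 // subr_ge0.
Qed.

Lemma sum_inj_le (R : numDomainType) (I T : finType) (z : I -> T) (f : T -> R) :
  injective z -> (forall x, 0 <= f x) -> \sum_i f (z i) <= \sum_x f x.
Proof.
move=> z_inj f0; rewrite (partition_big z xpredT) //=; apply: ler_sum => x _.
have [i /eqP zi|no_i] := pickP (fun i => z i == x); last by rewrite big_pred0.
by rewrite (big_pred1 i) ?zi // => k; rewrite /= -zi (inj_eq z_inj).
Qed.

(** * Large sieve over disjoint windows *)

Section LargeSieve.

Variables (p : nat) (psi : 'F_p -> algC).
Hypothesis pr_p : prime p.
Hypothesis psiD : forall u v, psi (u + v) = psi u * psi v.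
Hypothesis psi0 : psi 0 = 1.
Hypothesis psi_neq1 : exists u, psi u != 1.

Lemma parseval_Fp (I : finType) (w : I -> 'F_p) (c : I -> algC) : injective w ->
  \sum_a `|\sum_i c i * psi (a * w i)| ^+ 2 = p%:R * \sum_i `|c i| ^+ 2.
Proof.
move=> w_inj.
transitivity (\sum_i \sum_j c i * (c j)^* * \sum_a psi ((w i - w j) * a)).
  under eq_bigr => a _.
    rewrite normCK rmorph_sum mulr_suml.
    under eq_bigr do rewrite mulr_sumr.
    over.
  rewrite exchange_big; apply: eq_bigr => i _ /=.
  rewrite exchange_big; apply: eq_bigr => j _ /=; rewrite mulr_sumr.
  apply: eq_bigr => a _; rewrite rmorphM /= (conj_psi pr_p psiD psi0).
  by rewrite mulrACA -psiD -mulrBr mulrC [(w i - _) * _]mulrC mulrC.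
rewrite mulr_sumr; apply: eq_bigr => i _.
rewrite (bigD1 i) //= [X in _ + X]big1 => [|j ji].
  by rewrite (sum_psiM pr_p psiD psi0 psi_neq1) subrr eqxx addr0 normCK mulrC.
by rewrite (sum_psiM pr_p psiD psi0 psi_neq1) subr_eq0 (inj_eq w_inj) eq_sym (negPf ji) mulr0.
Qed.

(** For a = 0 the sum is -1; otherwise scaling x by a gives the Kloosterman sum of parameter a b. *)
Lemma kloosterman2_le (a b : 'F_p) : b != 0 ->
  `|\sum_(x | x != 0) psi (a * x + b / x)| ^+ 2 <= (4 * p)%:R.
Proof.
move=> b0; have [->|a0] := eqVneq a 0.
  have -> : \sum_(x : 'F_p | x != 0) psi (0 * x + b / x) = -1.
    rewrite (reindex_inj invr_inj) /=.
    have := sum_psiM pr_p psiD psi0 psi_neq1 b; rewrite (negPf b0) (bigD1 0) //=.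
    rewrite mulr0 psi0 => /(canRL (addKr _)); rewrite addr0 => <-.
    by apply: eq_big => [x|x _]; rewrite ?invr_eq0 // mul0r add0r invrK.
  by rewrite normrN1 expr1n ler1n muln_gt0 (prime_gt0 pr_p).
have -> : \sum_(x | x != 0) psi (a * x + b / x) = kloosterman psi (a * b).
  rewrite /kloosterman [RHS](reindex_inj (mulfI a0)).
  apply: eq_big => [x|x x0] /=; first by rewrite mulf_eq0 negb_or a0.
  by congr psi; field; rewrite x0.
have := kloosterman_real (a * b) pr_p psiD psi0.
move/real_normK->; apply: kloosterman_sqr_le => //.
by rewrite mulf_neq0.
Qed.

(** The inner sum is a convolution, so its Fourier transform is a Kloosterman sum times the
    transform of the window. The first factor has square at most 4 p, and Parseval is applied on
    both sides. *)
Lemma shifted_kloosterman_le (I : finType) (w : I -> 'F_p) (b : 'F_p) :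
  injective w -> b != 0 ->
  \sum_x `|\sum_i (if x + w i == 0 then 0 else psi (b / (x + w i)))| ^+ 2 <=
  (4 * p * #|I|)%:R.
Proof.
move=> w_inj b0; have p0 : 0 < p%:R :> algC by rewrite ltr0n prime_gt0.
pose phi x := if x == 0 then 0 else psi (b / x).
rewrite -(ler_pM2l p0) -(parseval_Fp _ (@inj_id _)).
under eq_bigr => a _.
  have -> : \sum_x (\sum_i phi (x + w i)) * psi (a * x) =
      (\sum_(x | x != 0) psi (a * x + b / x)) * (\sum_i 1 * psi (a * - w i)).
    under eq_bigr do rewrite mulr_suml.
    rewrite exchange_big mulr_sumr; apply: eq_bigr => i _ /=.
    rewrite (reindex_inj (addIr (- w i))) mulr_suml [RHS]big_mkcond.
    apply: eq_bigr => x _ /=; rewrite subrK /phi; case: eqP => _; first by rewrite mul0r.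
    by rewrite mul1r -!psiD; congr psi; ring.
  rewrite normrM exprMn; over.
apply: (@le_trans _ _ (\sum_a (4 * p)%:R * `|\sum_i 1 * psi (a * - w i)| ^+ 2)).
  by apply: ler_sum => a _; rewrite ler_wpM2r ?exprn_ge0 // kloosterman2_le.
rewrite -mulr_sumr parseval_Fp; last by move=> i j /oppr_inj/w_inj.
under eq_bigr do rewrite normr1 expr1n.
by rewrite sumr_const -!natrM mulnCA.
Qed.

(* The [b = 0] frequency contributes [#|V|^2 #|W|^2] to a character sum which
   vanishes, so the other frequencies must compensate it. *)
Lemma hyperbola_avoid_le (J V W : finType) (t : J -> 'F_p) (z : J * V -> 'F_p)
    (f : V -> 'F_p) (g : W -> 'F_p) :
  injective z -> injective f -> injective g ->
  (forall j v u, z (j, v) + f u != 0) ->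
  (forall j v u k l, (z (j, v) + f u) * (t j + g k + g l) != 1) ->
  (0 < #|J|)%N -> (0 < #|V|)%N -> (0 < #|W|)%N ->
  (#|J| * #|V| ^ 2 * #|W| ^ 2 <= 4 * p ^ 3)%N.
Proof.
move=> z_inj f_inj g_inj z_neq0 no_sol J0 V0 W0.
pose Phi b x := \sum_u (if x + f u == 0 then 0 else psi (b / (x + f u))).
pose G b := \sum_k psi (- b * g k).
have vanish j : \sum_b (\sum_v Phi b (z (j, v))) * (psi (- b * t j) * G b ^+ 2) = 0.
  have term b : (\sum_v Phi b (z (j, v))) * (psi (- b * t j) * G b ^+ 2) =
      \sum_v \sum_u \sum_k \sum_l
        psi (((z (j, v) + f u)^-1 - (t j + g k + g l)) * b).
    rewrite mulr_suml; apply: eq_bigr => v _; rewrite mulr_suml; apply: eq_bigr => u _.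
    have -> : G b ^+ 2 = \sum_k \sum_l psi (- b * g k) * psi (- b * g l).
      rewrite expr2 {1}/G mulr_suml; apply: eq_bigr => k _.
      by rewrite /G mulr_sumr.
    rewrite (negPf (z_neq0 j v u)) mulrA mulr_sumr; apply: eq_bigr => k _.
    rewrite mulr_sumr; apply: eq_bigr => l _; rewrite -!psiD; congr psi; ring.
  under eq_bigr do rewrite term.
  rewrite exchange_big big1 // => v _ /=; rewrite exchange_big big1 // => u _ /=.
  rewrite exchange_big big1 // => k _ /=; rewrite exchange_big big1 // => l _ /=.
  rewrite (sum_psiM pr_p psiD psi0 psi_neq1) subr_eq0 ifN //.
  apply: contra (no_sol j v u k l) => /eqP <-.
  by rewrite divff.
have G0 : G 0 = #|W|%:R.
  by rewrite /G; under eq_bigr do rewrite oppr0 mul0r psi0; rewrite sumr_const.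
have Phi0 j v : Phi 0 (z (j, v)) = #|V|%:R.
  rewrite /Phi; under eq_bigr => u _ do rewrite (negPf (z_neq0 j v u)) mul0r psi0.
  by rewrite sumr_const.
have le_j j : (#|V| ^ 2 * #|W| ^ 2)%:R <=
    \sum_(b | b != 0) `|G b| ^+ 2 * \sum_v `|Phi b (z (j, v))|.
  have := vanish j; rewrite (bigD1 0) //= G0 oppr0 mul0r psi0 mul1r.
  under [X in X * _ + _]eq_bigr do rewrite Phi0.
  rewrite sumr_const -natrX -[_ *+ _]mulr_natr -!natrM mulnn => /eqP.
  rewrite addr_eq0 => /eqP eq_main; rewrite -[_%:R]ger0_norm ?ler0n // eq_main normrN.
  apply: (le_trans (ler_norm_sum _ _ _)); apply: ler_sum => b _.
  rewrite !normrM (psi_norm pr_p psiD psi0) mul1r -expr2 mulrC.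
  by rewrite ler_wpM2l ?exprn_ge0 // ler_norm_sum.
pose E : algC := (#|J| * #|V| * (4 * p * #|V|))%:R.
have E0 : 0 <= E by rewrite ler0n.
(* Cauchy-Schwarz over all pairs (j, v) at once: the points [z] are distinct, so the mean square
   over the whole of ['F_p] controls every window together. *)
have cauchy b : b != 0 -> \sum_jv `|Phi b (z jv)| <= sqrtC E.
  move=> b0; have S0 : 0 <= \sum_jv `|Phi b (z jv)| by apply: sumr_ge0.
  rewrite -(ler_pXn2r (n := 2)) ?nnegrE ?sqrtC_ge0 // sqrtCK.
  apply: le_trans (sqr_sum_le _) _ => [jv|]; first exact: normr_real.
  rewrite card_prod [E]natrM ler_wpM2l ?ler0n //.
  apply: le_trans (shifted_kloosterman_le f_inj b0).
  by apply: (@sum_inj_le _ _ _ z (fun x => `|Phi b x| ^+ 2)) => // x; rewrite exprn_ge0.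
have sumG : \sum_(b | b != 0) `|G b| ^+ 2 <= (p * #|W|)%:R.
  have := @parseval_Fp W (fun k => - g k) (fun _ => 1) (inj_comp oppr_inj g_inj).
  have -> : \sum_(k : W) `|1 : algC| ^+ 2 = #|W|%:R.
    by under eq_bigr do rewrite normr1 expr1n; rewrite sumr_const.
  rewrite -natrM => <-; rewrite [leRHS](bigD1 0) //=.
  rewrite -[leLHS]add0r lerD ?exprn_ge0 //; apply: ler_sum => b _.
  have -> : \sum_k 1 * psi (b * - g k) = G b; last exact: lexx.
  by apply: eq_bigr => k _; rewrite mul1r mulrN -mulNr.
have le_total : (#|J| * (#|V| ^ 2 * #|W| ^ 2))%:R <= (p * #|W|)%:R * sqrtC E.
  rewrite natrM mulr_natl -sumr_const.
  apply: le_trans (ler_sum _ (fun j _ => le_j j)) _.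
  rewrite exchange_big /=.
  apply: (@le_trans _ _ (\sum_(b | b != 0) `|G b| ^+ 2 * sqrtC E)).
    apply: ler_sum => b b0; rewrite -mulr_sumr ler_wpM2l ?exprn_ge0 //.
    rewrite pair_bigA; apply: le_trans (cauchy b b0).
    by rewrite le_eqVlt; apply/orP; left; apply/eqP; apply: eq_bigr => -[].
  by rewrite -mulr_suml ler_wpM2r ?sqrtC_ge0.
(* After squaring, a common factor [#|J| * #|V| ^ 2 * #|W| ^ 2] cancels. *)
have : ((#|J| * (#|V| ^ 2 * #|W| ^ 2)) ^ 2 <=
    (p * #|W|) ^ 2 * (#|J| * #|V| * (4 * p * #|V|)))%N.
  rewrite -(ler_nat algC) [leLHS]natrX [leRHS]natrM [X in _ <= X * _]natrX -/E.
  rewrite -[X in _ * X](sqrtCK E) -exprMn.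
  by rewrite ler_pXn2r // ?nnegrE ?mulr_ge0 ?ler0n ?sqrtC_ge0.
move: #|J| #|V| #|W| J0 V0 W0; clear => a v w a0 v0 w0 le_sq.
have pos : (0 < a * v ^ 2 * w ^ 2)%N by rewrite !muln_gt0 a0 v0 w0.
rewrite -(leq_pmul2l pos).
have -> : (a * v ^ 2 * w ^ 2 * (a * v ^ 2 * w ^ 2) = (a * (v ^ 2 * w ^ 2)) ^ 2)%N by ring.
apply: leq_trans le_sq _.
by have -> : (a * v ^ 2 * w ^ 2 * (4 * p ^ 3) =
  (p * w) ^ 2 * (a * v * (4 * p * v)))%N by ring.
Qed.
End LargeSieve.

Lemma intr_Fp_inj (p : nat) (x y : int) : prime p -> 0 < x < p -> 0 < y < p ->
  x%:~R = y%:~R :> 'F_p -> x = y.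
Proof.
move=> pr_p xp yp /eqP; rewrite -subr_eq0 -rmorphB -(dvdz_pcharf (pchar_Fp pr_p)).
move/dvdzP=> [k xy]; have [k0|k0] := eqVneq k 0; first by lia.
have : p%:Z <= `|k| * p%:Z by rewrite ler_peMl // -gtz0_ge1 normr_gt0.
rewrite -[p%:Z in X in _ <= X]ger0_norm // -normrM -xy => ple.
by exfalso; lia.
Qed.

(** Offsets up to 2 (m - 1) arise as v + u with v, u < m: the points s j + v are distinct modulo p,
    and u is the smoothing variable. In the same way the second coordinate is t j + k + l, where n
    <= p keeps the k < n distinct modulo p. *)
Lemma modular_hyperbola_blocks (p J m n : nat) (s t : 'I_J -> int) :
  prime p -> (0 < J)%N -> (0 < m)%N -> (0 < n <= p)%N ->
  (forall j (a : nat), (a <= (m.-1).*2)%N -> 0 < s j + a < p) ->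
  (forall j k (a c : nat), (a < m)%N -> (c < m)%N -> s j + a = s k + c -> j = k) ->
  (4 * p ^ 3 < J * m ^ 2 * n ^ 2)%N ->
  exists (j : 'I_J) (a c : nat), [/\ (a <= (m.-1).*2)%N, (c <= (n.-1).*2)%N
    & ((s j + a) * (t j + c) = 1 %[mod p])%Z].
Proof.
move=> pr_p J0 m0 /andP[n0 n_le_p] s_range s_disj lt_J.
have [psi [psiD psi0 psi1]] := exists_additive_char pr_p.
have range2 (u v : 'I_m) : (u + v <= (m.-1).*2)%N by have := ltn_ord u; have := ltn_ord v; lia.
have range1 (u : 'I_m) : (u <= (m.-1).*2)%N by have := ltn_ord u; lia.
pose z (q : 'I_J * 'I_m) : 'F_p := (s q.1 + q.2%:Z)%:~R.
pose f (u : 'I_m) : 'F_p := u%:R.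
pose g (k : 'I_n) : 'F_p := k%:R.
have zf j v u : z (j, v) + f u = (s j + (v + u)%N)%:~R.
  by rewrite /z /f /= -[u%:R]/(u%:Z%:~R) -rmorphD /= -addrA PoszD.
have z_inj : injective z.
  move=> [j v] [k u] /= /intr_Fp_inj
    -/(_ pr_p (s_range _ _ (range1 _)) (s_range _ _ (range1 _))) /= E.
  have jk := s_disj _ _ _ _ (ltn_ord v) (ltn_ord u) E; subst k.
  by congr (_, _); apply/val_inj; move: E => /addrI[].
have j0 : 'I_J by exact: Ordinal J0.
have v0 : 'I_m by exact: Ordinal m0.
have f_inj : injective f.
  move=> u v fuv; apply/val_inj; have : z (j0, v0) + f u = z (j0, v0) + f v by rewrite fuv.
  by rewrite !zf => /intr_Fp_inj
    -/(_ pr_p (s_range _ _ (range2 _ _)) (s_range _ _ (range2 _ _))) /addrI[] /addnI.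
have g_inj : injective g.
  move=> k l /(congr1 (fun c : 'F_p => c : nat)); rewrite !val_Fp_nat //.
  by rewrite !modn_small ?(leq_trans (ltn_ord _)) // => /val_inj.
have [sol|no_sol] := boolP [exists j, exists v, exists u, exists k, exists l,
    (z (j, v) + f u) * ((t j)%:~R + g k + g l) == 1].
  case/existsP: sol => j /existsP[v /existsP[u /existsP[k /existsP[l /eqP E]]]].
  exists j, (v + u)%N, (k + l)%N; split=> //.
    by have := ltn_ord k; have := ltn_ord l; lia.
  apply/eqP; rewrite eqz_mod_dvd (dvdz_pcharf (pchar_Fp pr_p)) rmorphB rmorphM /= -zf.
  rewrite subr_eq0; apply/eqP; rewrite -[RHS]E; congr (_ * _).
  by rewrite PoszD !rmorphD /= addrA.
suff : (#|'I_J| * #|'I_m| ^ 2 * #|'I_n| ^ 2 <= 4 * p ^ 3)%N.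
  by rewrite !card_ord leqNgt lt_J.
apply: (hyperbola_avoid_le pr_p psiD psi0 psi1 (t := fun j => (t j)%:~R)
  z_inj f_inj g_inj); rewrite ?card_ord //.
  move=> j v u; rewrite zf; apply/eqP => zf0; have := s_range j _ (range2 v u).
  move/andP=> [s0 sp]; have : (p %| s j + (v + u)%N)%Z.
    by rewrite (dvdz_pcharf (pchar_Fp pr_p)) zf0.
  case/dvdzP=> k E; rewrite E in s0 sp.
  have p0 : 0 < p%:Z by rewrite ltz_nat prime_gt0.
  move: s0; rewrite pmulr_lgt0 // => k0.
  by move: sp; rewrite ltNge ler_peMl // ltW.
move=> j v u k l; apply: contraNneq no_sol => E.
apply/existsP; exists j; apply/existsP; exists v; apply/existsP; exists u.
by apply/existsP; exists k; apply/existsP; exists l; apply/eqP.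
Qed.

(** * Real intervals *)

Local Open Scope classical_set_scope.
Local Open Scope ring_scope.

Lemma interval_of_measure (R : realType) (I : interval R) (L : R) : 0 < L ->
  lebesgue_measure [set` I] = L%:E ->
  exists c : R, forall x, c < x < c + L -> x \in I.
Proof.
move=> L0; rewrite lebesgue_measure_itv; case: ifP => [|_ /esym/eqP]; last first.
  by rewrite eqe gt_eqF.
case: I => [[b1 c|[]] [b2 d|[]]] //= _ [LE]; exists c => x /andP[cx xd].
rewrite in_itv /=; move: xd; rewrite -LE subrKC => xd.
by apply/andP; split; apply: lteifS.
Qed.

Lemma integers_in_interval (R : realType) (I : interval R) (L : R) (m : nat) :
  0 < L -> (0 < m)%N -> (2 * m)%:R <= L -> lebesgue_measure [set` I] = L%:E ->
  exists s : int, forall a : nat, (a <= (m.-1).*2)%N -> (s + a)%:~R \in I.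
Proof.
move=> L0 m0 mL /(interval_of_measure L0)[c cI].
(* The first integer beyond [c] is at most c + 1, so the last one needed is at most c + 2 m - 1 < c
   + L. *)
exists (Num.floor c + 1) => a a_le; apply: cI.
have c1 : c < (Num.floor c + 1)%:~R by exact: floorD1_gt.
have c2 : (Num.floor c)%:~R <= c by exact: floor_le.
rewrite !rmorphD /= rmorph1 in c1 *.
have a0 : 0 <= (a%:R : R) by exact: ler0n.
have aL : (a%:R : R) <= 2 * m%:R - 2.
  rewrite lerBrDr -!natrM -natrD ler_nat; by move: a_le m0; clear; lia.
by rewrite natrM in mL; rewrite -[a%:~R]/(a%:R); lra.
Qed.

Lemma sum_disjoint_itv_le (R : realType) (p J : nat) (H : R) (I : 'I_J -> interval R) :
  (forall j, [set` I j] `<=` `]0, p%:R[) ->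
  (forall j, lebesgue_measure [set` I j] = H%:E) ->
  (forall j k, j <> k -> [set` I j] `&` [set` I k] = set0) ->
  J%:R * H <= p%:R.
Proof.
move=> sub mu disj.
have mI j : measurable [set` I j] by exact: measurable_itv.
have tI : trivIset setT (fun j => [set` I j]).
  by apply/trivIsetP => j k _ _ /eqP jk; apply: disj.
have mu_union : lebesgue_measure (\big[setU/set0]_(j < J) [set` I j]) = (J%:R * H)%:E.
  rewrite measure_bigsetU_ord //= (eq_bigr (fun=> H%:E)) => [|j _]; last exact: mu.
  by rewrite sumEFin sumr_const card_ord mulr_natl.
have : (lebesgue_measure (\big[setU/set0]_(j < J) [set` I j]) <=
    lebesgue_measure `]0%R, (p%:R : R)[)%E.
  apply: le_measure; rewrite ?inE //; first exact: bigsetU_measurable.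
  by rewrite -bigcup_seq => x [j _]; apply: sub.
rewrite mu_union lebesgue_measure_itv /=.
case: ifP => _; rewrite ?lee_fin ?subr0 // => /le_trans; apply; exact: ler0n.
Qed.

(** The bound ln (1 + x) <= x at x = - 1 / 2 gives ln 2 >= 1 / 2. It turns the factor (log p)^4 into
    the constant 1 / 16. *)
Lemma ln_nat_ge_half (R : realType) (p : nat) : (1 < p)%N -> 1 / 2 <= ln (p%:R : R).
Proof.
move=> p1; apply: (@le_trans _ _ (ln 2)); last first.
  by rewrite ler_ln ?posrE ?ltr0n ?ler_nat // ltnW.
have := @le_ln1Dx R (- (1 / 2)); have -> : 1 + - (1 / 2) = 2^-1 :> R by field.
rewrite lnV ?posrE // => le_ln.
by have := le_ln ltac:(lra); lra.
Qed.

Lemma ltn_leq_double_pred (a m : nat) : (a < m)%N -> (a <= (m.-1).*2)%N.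
Proof. by lia. Qed.

Lemma truncn_half_bounds (R : realType) (L : R) : 2 <= L ->
  [/\ (0 < Num.truncn (L / 2))%N, (2 * Num.truncn (L / 2))%:R <= L
    & L <= 4 * (Num.truncn (L / 2))%:R].
Proof.
move=> L2; have L20 : 0 <= L / 2 by lra.
have /andP[le_t lt_t] := truncn_itv L20.
set k := Num.truncn _ in le_t lt_t *.
have k1 : (0 < k)%N by rewrite truncn_gt0; lra.
have k1R : 1 <= k%:R :> R by rewrite ler1n.
rewrite -[k.+1%:R]natr1 in lt_t; split=> //; first by rewrite natrM; lra.
by lra.
Qed.

Theorem theorem1 (R : realType) :
  exists C : R, 0 < C /\
    forall (p : nat) (H K : R) (J : nat) (I1 I2 : 'I_J -> interval R),
      prime p -> 0 < H -> 0 < K -> (1 <= J)%N ->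
      (forall j : 'I_J, [set` I1 j] `<=` `]0, p%:R[) ->
      (forall j : 'I_J, [set` I2 j] `<=` `]0, p%:R[) ->
      (forall j : 'I_J, lebesgue_measure [set` I1 j] = H%:E) ->
      (forall j : 'I_J, lebesgue_measure [set` I2 j] = K%:E) ->
      (forall j k : 'I_J, j <> k -> [set` I1 j] `&` [set` I1 k] = set0) ->
      C * (p%:R ^+ 3 * ln p%:R ^+ 4 / (H ^+ 2 * K ^+ 2)) <= J%:R ->
      exists (j : 'I_J) (x y : int),
        [/\ x%:~R \in I1 j, y%:~R \in I2 j & (x * y = 1 %[mod p])%Z].
Proof.
(* 2^15 = 16 * 256 * 8: 16 pays for (log p)^4 >= 1 / 16, 256 for H <= 4 m and K <= 4 n squared, and
   8 leaves a strict margin over 4 p^3. *)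
exists (2 ^ 15)%:R; split=> [|p H K J I1 I2 pr_p H0 K0 J1 sub1 sub2 mu1 mu2 disj le_J].
  by rewrite ltr0n expn_gt0.
have p0 : 0 < p%:R :> R by rewrite ltr0n prime_gt0.
have JH : J%:R * H <= p%:R by exact: sum_disjoint_itv_le disj.
have J1R : 1 <= J%:R :> R by rewrite ler1n.
have Hp : H <= p%:R by apply: le_trans JH; rewrite ler_peMl // ltW.
have Kp : K <= p%:R.
  rewrite -[K]mul1r; apply: (@sum_disjoint_itv_le R p 1 K (fun=> I2 (Ordinal J1))) => //.
  by move=> j k []; rewrite [j]ord1 [k]ord1.
have key : 8 * 256 * p%:R ^+ 3 <= J%:R * H ^+ 2 * K ^+ 2.
  have HK0 : 0 < H ^+ 2 * K ^+ 2 by rewrite mulr_gt0 // exprn_gt0.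
  rewrite -[leRHS]mulrA -ler_pdivrMr //; apply: le_trans le_J.
  have ln4 : 1 / 16 <= ln (p%:R : R) ^+ 4.
    have h := ln_nat_ge_half R (prime_gt1 pr_p).
    have -> : 1 / 16 = (1 / 2) ^+ 4 :> R by field.
    by rewrite lerXn2r // nnegrE; lra.
  rewrite mulrA ler_wpM2r ?invr_ge0 ?(ltW HK0) //.
  have p3 : 0 < p%:R ^+ 3 :> R by rewrite exprn_gt0.
  have := ler_wpM2l (ltW p3) ln4.
  have -> : (2 ^ 15)%:R = 8 * 256 * 16 :> R by rewrite -!natrM.
  by move: (p%:R ^+ 3) (ln _ ^+ 4) => u v; lra.
(* Disjointness enters through J H <= p. The resulting bound forces H >= 2 because K <= p, and K >=
   2 because K < 2 would give H K^2 <= 4 p; hence [m] and [n] below are positive. *)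
have HK2 : 2048 * p%:R ^+ 2 <= H * K ^+ 2.
  rewrite -(ler_pM2l p0); apply: (@le_trans _ _ (J%:R * H ^+ 2 * K ^+ 2)).
    apply: le_trans key; rewrite le_eqVlt; apply/orP; left; apply/eqP; ring.
  have := ler_wpM2r (ltW (mulr_gt0 H0 (exprn_gt0 2 K0))) JH.
  by congr (_ <= _); ring.
have H2 : 2 <= H.
  have K2p : K ^+ 2 <= p%:R ^+ 2 by rewrite lerXn2r // nnegrE ltW.
  have := ler_wpM2l (ltW H0) K2p => /(le_trans HK2).
  rewrite ler_pM2r ?exprn_gt0 //; lra.
have K2 : 2 <= K.
  rewrite leNgt; apply/negP => K2.
  have K4 : K ^+ 2 <= 4 by rewrite expr2; nra.
  have := le_trans HK2 (ler_pM (ltW H0) (exprn_ge0 2 (ltW K0)) Hp K4).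
  have p1 : 1 <= p%:R :> R by rewrite ler1n prime_gt0.
  rewrite expr2; nra.
have [m0 mH Hm] := truncn_half_bounds H2.
have [n0 nK Kn] := truncn_half_bounds K2.
set m := Num.truncn (H / 2) in m0 mH Hm; set n := Num.truncn (K / 2) in n0 nK Kn.
have /boolp.choice[s sI] := fun j => integers_in_interval H0 m0 mH (mu1 j).
have /boolp.choice[t tI] := fun j => integers_in_interval K0 n0 nK (mu2 j).
have np : (0 < n <= p)%N.
  by rewrite n0 -(ler_nat R); rewrite natrM in nK; have := ler0n R n; lra.
have s_range j (a : nat) : (a <= (m.-1).*2)%N -> 0 < s j + a < p.
  move=> /sI-/(_ j) sa; have := sub1 j _ sa.
  by rewrite /= in_itv /= ltr0z -[p%:R]/(p%:~R) ltr_int.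
have s_disj j k (a c : nat) : (a < m)%N -> (c < m)%N -> s j + a = s k + c -> j = k.
  move=> am cm E; apply/eqP; apply/negPn/negP => /eqP jk.
  have /seteqP[/(_ (s j + a)%:~R) no_x _] := disj _ _ jk; apply: no_x; split => /=.
    exact/sI/ltn_leq_double_pred.
  by rewrite E; apply/sI/ltn_leq_double_pred.
have gt_J : (4 * p ^ 3 < J * m ^ 2 * n ^ 2)%N.
  rewrite -(ltr_nat R) [ltLHS]natrM natrX.
  have -> : (J * m ^ 2 * n ^ 2)%:R = J%:R * m%:R ^+ 2 * n%:R ^+ 2 :> R.
    by rewrite !natrM !expr2.
  have H4 : H ^+ 2 <= 16 * m%:R ^+ 2.
    have -> : 16 * m%:R ^+ 2 = (4 * m%:R) ^+ 2 :> R by ring.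
    by rewrite lerXn2r // nnegrE ?(ltW H0) // mulr_ge0 ?ler0n.
  have K4 : K ^+ 2 <= 16 * n%:R ^+ 2.
    have -> : 16 * n%:R ^+ 2 = (4 * n%:R) ^+ 2 :> R by ring.
    by rewrite lerXn2r // nnegrE ?(ltW K0) // mulr_ge0 ?ler0n.
  have HK4 := ler_pM (exprn_ge0 2 (ltW H0)) (exprn_ge0 2 (ltW K0)) H4 K4.
  have := ler_wpM2l (ler0n R J) HK4; rewrite mulrA => /(le_trans key).
  have -> : J%:R * (16 * m%:R ^+ 2 * (16 * n%:R ^+ 2)) =
    256 * (J%:R * m%:R ^+ 2 * n%:R ^+ 2) :> R by ring.
  have : 0 < p%:R ^+ 3 :> R by rewrite exprn_gt0.
  by move: (p%:R ^+ 3) (J%:R * m%:R ^+ 2 * n%:R ^+ 2) => u v; lra.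
have [j [a [c [am cn E]]]] :=
  @modular_hyperbola_blocks p J m n s t pr_p J1 m0 np s_range s_disj gt_J.
by exists j, (s j + a), (t j + c); split; [exact: sI | exact: tI |].
Qed.
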